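(* Let $S$ be a semitopological semigroup. Then $WAP(S)$, the space of continuous weakly almost periodic functions on $S$, has a left invariant mean if and only if $S$ has the following fixed point property: $(F)$: Whenever $S$ acts on a nonempty weakly compact convex subset $K$ of a Banach space and the action is weakly separately continuous, weakly quasi-equicontinuous and nonexpansive, then $K$ contains a common fixed point for $S$, i.e. an element $x\in K$ with $s\cdot x=x$ for every $s\in S$.
   Context: A semitopological semigroup is a semigroup $S$ with a Hausdorff topology such that for each $t\in S$ the mappings $s\mapsto ts$ and $s\mapsto st$ from $S$ to $S$ are continuous. $\ell^\infty(S)$ is the Banach space of bounded complex-valued functions on $S$ with the supremum norm, and $C(S)$ is its closed subalgebra of bounded continuous functions. For $s\in S$ and $f\in\ell^\infty(S)$, the left translation is $l_sf(t)=f(st)$, $t\in S$. A function $f\in C(S)$ is weakly almost periodic if $\{l_sf:s\in S\}$ is relatively compact in the weak topology of $C(S)$; $WAP(S)$ is the space of all such functions. A left invariant mean (LIM) on a closed linear translation-invariant subspace $X$ of $\ell^\infty(S)$ containing the constants is a functional $m\in X^*$ with $\|m\|=m(1)=1$ and $m(l_sf)=m(f)$ for all $s\in S$, $f\in X$. An action of $S$ on $K$ (from the left) is a map $S\times K\to K$, $(s,x)\mapsto s\cdot x$, with $s\cdot(s'\cdot x)=(ss')\cdot x$ for all $s,s'\in S$, $x\in K$. For $K$ a subset of a Banach space $E$, the action is: nonexpansive if $\|s\cdot x-s\cdot y\|\le\|x-y\|$ for all $x,y\in K$, $s\in S$; weakly separately continuous if, when $K$ carries the weak topology of $E$, the map $(s,x)\mapsto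 s\cdot x$ is continuous in each variable when the other is fixed; weakly quasi-equicontinuous if, when $K$ carries the weak topology of $E$, the closure of $\{x\mapsto s\cdot x : s\in S\}$ in $K^K$ with the product topology consists only of continuous mappings $K\to K$. *)

(* Defs.v *)
From HB Require Import structures.
From mathcomp Require Import all_boot all_order all_algebra.
From mathcomp Require Import complex.
From mathcomp Require Import all_classical all_reals all_analysis.

Set Implicit Arguments.
Unset Strict Implicit.
Unset Printing Implicit Defensive.
Import ComplexField.Normc.
Import Order.TTheory GRing.Theory Num.Theory.
Import numFieldNormedType.Exports.
Local Open Scope classical_set_scope.
Local Open Scope ring_scope.
Local Open Scope complex_scope.

HB.mixin Record isSemitopological S & Semigroup S & Topological S := {
  semitop_hausdorff : hausdorff_space S;
  mulg_continuousl : forall t : S, continuous (fun s : S => (t * s)%g);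
  mulg_continuousr : forall t : S, continuous (fun s : S => (s * t)%g)
}.

#[short(type="semitopologicalSemigroupType")]
HB.structure Definition SemitopologicalSemigroup :=
  { S of Semigroup S & Topological S & isSemitopological S }.

Definition dual (K : numFieldType) (E : normedModType K) :=
  {phi : {linear E -> K^o} | continuous phi}.

Definition dual_eval (K : numFieldType) (E : normedModType K) (x : E) :
  {ptws dual E -> K^o} := fun phi : dual E => sval phi x.

Definition weak (K : numFieldType) (E : normedModType K) :=
  initial_topology (@dual_eval K E).
HB.instance Definition _ (K : numFieldType) (E : normedModType K) :=
  Topological.copy (weak E) (initial_topology (@dual_eval K E)).

Definition weak_subset (K : numFieldType) (E : normedModType K) (A : set E) :=
  set_type (A : set (weak E)).
HB.instance Definition _ (K : numFieldType) (E : normedModType K) (A : set E) :=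
  Topological.copy (weak_subset A) (set_type (A : set (weak E))).

Section bounded_continuous_functions.
Context (R : realType) (S : topologicalType).

Lemma normc_ge0 (z : R[i]) : 0 <= normc z.
Proof. by case: z => a b; exact: sqrtr_ge0. Qed.

Lemma bounded_fun_normcP (f : S -> R[i]^o) :
  bounded_fun f <-> exists M : R, forall s, normc (f s) <= M.
Proof.
split => [[M [Mreal /(_ (M + 1))]]|[M fM]].
  rewrite ltrDl ltr01 => /(_ isT) fM; exists (complex.Re (M + 1)) => s.
  by have := fM s I; rewrite /= lecE => /andP[].
exists M%:C; split; first by rewrite complex_real.
move=> N MN s _ /=; apply: le_trans (ltW MN).
by rewrite lecR fM.
Qed.

Definition bounded_continuous : {pred S -> R[i]^o} :=
  fun f => `[< bounded_fun f /\ continuous f >].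

Record bcfun := BCFun {
  bcfun_val :> S -> R[i]^o;
  bcfunP : bcfun_val \in bounded_continuous }.

HB.instance Definition _ := [isSub for bcfun_val].
HB.instance Definition _ := [Choice of bcfun by <:].

(* Norms of normed modules over [R[i]] take values in [R[i]], hence the embedding
   [%:C] of this real supremum below. *)
Definition bcfun_norm (f : bcfun) : R := sup [set normc (f s) | s in [set: S]].

Lemma bounded_continuous_submod : submod_closed bounded_continuous.
Proof.
split.
  apply/asboolP; split; last exact: cst_continuous.
  by apply/bounded_fun_normcP; exists 0 => s; rewrite normc0.
move=> a f g /asboolP[/bounded_fun_normcP[M fM] fc].
move=> /asboolP[/bounded_fun_normcP[N gN] gc]; apply/asboolP; split.
  apply/bounded_fun_normcP; exists (normc a * M + N) => s.
  apply: le_trans (le_normcD _ _) _; rewrite lerD// normcM ler_wpM2l//.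
  exact: normc_ge0.
by move=> s; apply: cvgD; [apply: cvgZr; exact: fc|exact: gc].
Qed.

HB.instance Definition _ :=
  GRing.isSubmodClosed.Build _ _ bounded_continuous bounded_continuous_submod.
HB.instance Definition _ := [SubChoice_isSubLmodule of bcfun by <:].

Lemma bcfun_norm_ub (f : bcfun) s : normc (f s) <= bcfun_norm f.
Proof.
apply: ub_le_sup; last by exists s.
have /asboolP[/bounded_fun_normcP[M fM] _] := bcfunP f.
by exists M => _ [t _ <-].
Qed.

Lemma bcfun_norm_le (f : bcfun) M : 0 <= M ->
  (forall s, normc (f s) <= M) -> bcfun_norm f <= M.
Proof.
move=> M0 fM; rewrite /bcfun_norm.
have [->|/set0P ne] := eqVneq [set normc (f s) | s in [set: S]] set0.
  by rewrite sup0.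
by apply: ge_sup => // _ [t _ <-].
Qed.

Lemma bcfun_norm_ge0 (f : bcfun) : 0 <= bcfun_norm f.
Proof.
have [fS0|/set0P[_ [s _ _]]] := eqVneq [set normc (f s) | s in [set: S]] set0.
  by rewrite /bcfun_norm fS0 sup0.
exact: le_trans (normc_ge0 _) (bcfun_norm_ub f s).
Qed.

Lemma bcfun_normD f g :
  (bcfun_norm (f + g))%:C <= (bcfun_norm f)%:C + (bcfun_norm g)%:C.
Proof.
rewrite -rmorphD/= lecR; apply: bcfun_norm_le => [|s].
  by rewrite addr_ge0// bcfun_norm_ge0.
by apply: le_trans (le_normcD _ _) _; rewrite lerD// bcfun_norm_ub.
Qed.

Lemma bcfun_normZ (a : R[i]) f :
  (bcfun_norm (a *: f))%:C = `|a| * (bcfun_norm f)%:C.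
Proof.
have nZ b g : bcfun_norm (b *: g) <= normc b * bcfun_norm g.
  apply: bcfun_norm_le => [|s]; first by rewrite mulr_ge0// ?normc_ge0 ?bcfun_norm_ge0.
  by rewrite normcM ler_wpM2l ?normc_ge0 ?bcfun_norm_ub.
suff -> : bcfun_norm (a *: f) = normc a * bcfun_norm f by exact: rmorphM.
apply/eqP; rewrite eq_le; apply/andP; split; first exact: nZ.
have [->|a0] := eqVneq a 0.
  by rewrite (@normc0 R) mul0r bcfun_norm_ge0.
have na0 : 0 < normc a.
  by rewrite lt_neqAle normc_ge0 andbT eq_sym; apply: contra_neq a0; exact: eq0_normc.
by rewrite -ler_pdivlMl// -normcV -{1}(scalerK a0 f).
Qed.

Lemma bcfun_norm0_eq0 f : (bcfun_norm f)%:C = 0 -> f = 0.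
Proof.
move=> /(congr1 (@complex.Re R))/= f0; apply/val_inj/funext => s /=.
apply: eq0_normc; apply/eqP; rewrite eq_le normc_ge0 andbT -f0.
exact: bcfun_norm_ub.
Qed.

HB.instance Definition _ :=
  @Lmodule_isNormed.Build R[i] bcfun (fun f => (bcfun_norm f)%:C)
    bcfun_normD bcfun_normZ bcfun_norm0_eq0.

Lemma bcfun_cst_subproof (c : R[i]) :
  (cst c : S -> R[i]^o) \in bounded_continuous.
Proof.
apply/asboolP; split; last exact: cst_continuous.
by apply/bounded_fun_normcP; exists (normc c).
Qed.

Definition bcfun_cst (c : R[i]) : bcfun := BCFun (bcfun_cst_subproof c).

End bounded_continuous_functions.

Section weakly_almost_periodic.
Context (R : realType) (S : semitopologicalSemigroupType).

Local Notation CS := (bcfun R S).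

Lemma left_translation_subproof (s : S) (f : CS) :
  ((fun t => f (s * t)%g) : S -> R[i]^o) \in @bounded_continuous R S.
Proof.
have /asboolP[/bounded_fun_normcP[M fM] fc] := bcfunP f.
apply/asboolP; split; first by apply/bounded_fun_normcP; exists M.
by move=> t; apply: continuous_comp; [exact: mulg_continuousl|exact: fc].
Qed.

Definition left_translation (s : S) (f : CS) : CS :=
  BCFun (left_translation_subproof s f).

Definition WAP : set CS :=
  [set f | @precompact (weak CS) [set left_translation s f | s in [set: S]]].

(* The norm of the functional [m] on the subspace [X] normed by [CS]; the values
   of [m] outside [X] play no role. *)
Definition functional_norm (X : set CS) (m : CS -> R[i]) : \bar R :=
  ereal_sup [set (normc (m f))%:E | f in [set f | X f /\ `|f| <= 1]].

Definition left_invariant_mean (X : set CS) (m : CS -> R[i]) : Prop :=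
  [/\ forall (a : R[i]) f g, X f -> X g -> m (a *: f + g) = a * m f + m g,
      functional_norm X m = 1%E,
      m (bcfun_cst S 1) = 1 &
      forall s f, X f -> m (left_translation s f) = m f].

End weakly_almost_periodic.

Section fixed_point_property.
Context (S : semitopologicalSemigroupType) (K : numFieldType).

Section actions.
Context (E : normedModType K) (A : set E).

Definition is_action (act : S -> weak_subset A -> weak_subset A) : Prop :=
  forall s t x, act s (act t x) = act (s * t)%g x.

Definition nonexpansive (act : S -> weak_subset A -> weak_subset A) : Prop :=
  forall s x y,
    `|(val (act s x) : E) - val (act s y)| <= `|(val x : E) - val y|.

Definition weakly_separately_continuous
    (act : S -> weak_subset A -> weak_subset A) : Prop :=
  (forall s, continuous (act s)) /\ (forall x, continuous (act ^~ x)).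

Definition weakly_quasi_equicontinuous
    (act : S -> weak_subset A -> weak_subset A) : Prop :=
  forall g : {ptws weak_subset A -> weak_subset A},
    closure (range act : set {ptws weak_subset A -> weak_subset A}) g ->
    continuous (g : weak_subset A -> weak_subset A).

End actions.

(* A Banach space over the scalars [K]; only [K := R] and [K := R[i]] are used. *)
Definition fixed_point_property : Prop :=
  forall (E : completeNormedModType K) (A : set E),
    A !=set0 -> compact (A : set (weak E)) ->
    convex_set (A : set (convex_lmodType E)) ->
  forall act : S -> weak_subset A -> weak_subset A,
    is_action act -> weakly_separately_continuous act ->
    weakly_quasi_equicontinuous act -> nonexpansive act ->
  exists x, forall s, act s x = x.

End fixed_point_property.

(* Main.v *)
Require Import Defs.
From HB Require Import structures.
From mathcomp Require Import all_boot all_order all_algebra.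
From mathcomp Require Import complex.
From mathcomp Require Import ring lra.
From mathcomp Require Import all_classical all_reals all_analysis.

(** Both implications rest on one form of Grothendieck's theorem,
    [functional_separately_continuous]: if [B x y] is bounded and separately
    continuous on a product of two compact sets and [L] is a bounded functional
    on the continuous functions of [x], then [L (B ^~ y)] depends continuously
    on [y]. It converts pointwise compactness into weak compactness. In place of
    an integral representation, [L] enters through its variation, which is
    additive on nonnegative continuous functions, and a failure of continuity
    produces two sequences whose iterated limits disagree.

    From a mean to a fixed point. Let [S] act on the weakly compact convex set
    [K]. By Zorn's lemma there are a minimal closed convex invariant set [K0]
    and, inside it, a minimal closed invariant set [F]; all closures are weak.
    By quasi-equicontinuity, the pointwise closure of [S] in the self-maps of
    [K], called the envelope, is a compact semigroup of continuous maps. For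
    [x0] in [F] and [u] weakly continuous on [K], Grothendieck's theorem shows
    that [t |-> u (t x0)] is weakly almost periodic ([orbit_fun_WAP]), so that
    the mean of [WAP] induces a mean on the continuous functions on [F]; this
    mean is invariant under [S], and, by Grothendieck's theorem once more,
    under the envelope ([mean_envelope]). Minimality of [F] makes it faithful,
    which forces the idempotents of the envelope to fix [F] pointwise
    ([idempotent_fixes]). With Ellis's theorem every element of the envelope
    becomes invertible on [F] ([envelope_left_inverse]), and as all of them are
    nonexpansive, [S] acts on [F] by surjective isometries. Now [F] has a
    nonempty relatively weakly open subset of small norm diameter
    ([fragmented]); finitely many of its translates cover [F], which is thus
    totally bounded in norm ([finite_net]). If [F] had positive diameter [D],
    iterated midpoints of a finite net would give a point of [K0] at distance
    at most some [r < D] from all of [F], and the set of all such points would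
    contradict the minimality of [K0]: this is DeMarr's argument, in
    [common_fixed_point]. It is carried out for a real vector space with a
    norm, so that it applies to a complex Banach space through its real
    structure.

    From fixed points to a mean. The means on the bounded continuous functions
    form a compact convex set for the topology of pointwise convergence, on
    which [S] acts by [(s m) f = m (l_s f)]. Given finitely many weakly almost
    periodic [f], the numbers [m f] and [m (l_u f)] form a bounded function of
    [f] and [u], hence a vector in a Banach space. By Grothendieck's theorem
    this vector depends weakly continuously on [m] ([weak_evaluation_map]), so
    these vectors form a weakly compact convex set; [S] acts on it by
    translations of [u], and a fixed point is a mean that is invariant on the
    given functions ([finite_invariant_mean]). Compactness of the set of means
    passes from finite families to all of [WAP] ([fixed_point_mean]). *)

Set Implicit Arguments.
Unset Strict Implicit.
Unset Printing Implicit Defensive.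
Import ComplexField.Normc.
Import Order.TTheory GRing.Theory Num.Theory.
Import numFieldNormedType.Exports.
Local Open Scope classical_set_scope.
Local Open Scope ring_scope.

(** * Cluster points and closed sets *)

Section cluster_facts.
Context {T : topologicalType}.

Lemma cluster_closed (F : set_system T) (D : set T) p :
  cluster F p -> closed D -> F D -> D p.
Proof.
move=> Fp Dcl FD; apply: Dcl => U pU.
by have := Fp D U FD pU.
Qed.

Lemma closure_near (A U : set T) p : closure A p -> nbhs p U ->
  exists2 q, A q & U q.
Proof. by move=> Ap /Ap[q [Aq Uq]]; exists q. Qed.

Lemma compact_seq_cluster (X : set T) (u : nat -> T) : compact X ->
  (forall n, X (u n)) -> exists2 p, X p & cluster (u @ \oo) p.
Proof.
move=> Xc Xu; have [|p [Xp up]] := Xc (u @ \oo) _; last by exists p.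
by exists 0%N => // n _; exact: Xu.
Qed.

Lemma closed_preimage_ge (R : realType) (f : T -> R^o) (c : R) :
  continuous f -> closed [set x | c <= f x].
Proof.
move=> fc; apply: (@preimage_closed _ _ f [set y | c <= y]); last exact: closed_ge.
by move=> x _; exact: fc.
Qed.

Lemma closed_preimage_le (R : realType) (f : T -> R^o) (c : R) :
  continuous f -> closed [set x | f x <= c].
Proof.
move=> fc; apply: (@preimage_closed _ _ f [set y | y <= c]); last exact: closed_le.
by move=> x _; exact: fc.
Qed.

Lemma continuous_abs (R : realType) (f : T -> R^o) :
  continuous f -> continuous (fun x => `|f x| : R^o).
Proof. by move=> fc x; apply: cvg_norm; exact: fc. Qed.

Lemma continuous_maxr (R : realType) (f g : T -> R^o) : continuous f ->
  continuous g -> continuous (fun x => Num.max (f x) (g x) : R^o).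
Proof. by move=> fc gc x; exact: (continuous_max (fc x) (gc x)). Qed.

Lemma continuous_minr (R : realType) (f g : T -> R^o) : continuous f ->
  continuous g -> continuous (fun x => Num.min (f x) (g x) : R^o).
Proof. by move=> fc gc x; exact: (continuous_min (fc x) (gc x)). Qed.

End cluster_facts.

(** * The variation of a functional *)

Section functional_variation_section.
Context (R : realType) (T : topologicalType) (X : set T).
Variables (L : (T -> R^o) -> R) (C : R).
Hypothesis C0 : 0 <= C.
Hypothesis Llin : forall (a : R) (f g : T -> R^o), continuous f -> continuous g ->
  L (fun x => a * f x + g x) = a * L f + L g.
Hypothesis Lle : forall (f : T -> R^o) (M : R), continuous f ->
  (forall x, X x -> `|f x| <= M) -> L f <= C * M.

(** The value at [g >= 0] of the absolute value of [L], defined as for the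
    variation of a measure. *)
Definition functional_variation (g : T -> R^o) : R :=
  sup [set L h | h in [set h : T -> R^o |
    continuous h /\ forall x, X x -> `|h x| <= g x]].

Definition bounded_nneg (M : R) (g : T -> R^o) :=
  continuous g /\ forall x, X x -> 0 <= g x <= M.

Lemma functional_variation_ub M g h : (forall x, X x -> g x <= M) ->
  continuous h -> (forall x, X x -> `|h x| <= g x) -> L h <= functional_variation g.
Proof.
move=> gM hc hg; apply: ub_le_sup; last by exists h.
exists (C * M) => _ [k [kc kg] <-]; apply: Lle => // x Xx.
exact: le_trans (kg x Xx) (gM x Xx).
Qed.

Lemma functional_variation_le g c : (forall x, X x -> 0 <= g x) ->
  (forall h : T -> R^o, continuous h -> (forall x, X x -> `|h x| <= g x) -> L h <= c) ->
  functional_variation g <= c.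
Proof.
move=> g0 H; apply: ge_sup => [|_ [h [hc hg] <-]]; last exact: H.
exists (L (fun=> 0)), (fun=> 0); split=> //; first by move=> x; exact: cvg_cst.
by move=> x Xx; rewrite normr0 g0.
Qed.

Lemma functional_variation_bounded M g : (forall x, X x -> 0 <= g x <= M) ->
  functional_variation g <= C * M.
Proof.
move=> gM; apply: functional_variation_le => [x /gM/andP[]//|h hc hg].
by apply: Lle => // x Xx; have /andP[_] := gM x Xx; exact: le_trans (hg x Xx).
Qed.

Lemma functional_variation_mono M f g : (forall x, X x -> 0 <= f x) ->
  (forall x, X x -> f x <= g x) -> (forall x, X x -> g x <= M) ->
  functional_variation f <= functional_variation g.
Proof.
move=> f0 fg gM; apply: functional_variation_le => // h hc hf.
apply: (@functional_variation_ub M) => // x Xx; exact: le_trans (hf x Xx) (fg x Xx).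
Qed.

Lemma functionalD (f g : T -> R^o) : continuous f -> continuous g ->
  L (fun x => f x + g x) = L f + L g.
Proof.
move=> fc gc; rewrite -[L f]mul1r -Llin//; congr L.
by apply/funext => x; rewrite mul1r.
Qed.

Lemma functional0 : L (fun=> 0) = 0.
Proof.
have c0 : continuous ((fun=> 0) : T -> R^o) by move=> x; exact: cvg_cst.
have := Llin (-1) c0 c0; rewrite [X in L X](_ : _ = fun=> 0).
  by rewrite mulN1r addNr.
by apply/funext => x; rewrite mulr0 addr0.
Qed.

(** Riesz decomposition: a function bounded by [a + b] is truncated at the
    levels [- a] and [a], which leaves a remainder bounded by [b]. *)
Lemma functional_variation_leD M a b : bounded_nneg M a -> bounded_nneg M b ->
  functional_variation (fun x => a x + b x) <= functional_variation a + functional_variation b.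
Proof.
move=> [ac a0] [bc b0]; apply: functional_variation_le => [x Xx|h hc hab].
  by have /andP[? _] := a0 x Xx; have /andP[? _] := b0 x Xx; rewrite addr_ge0.
pose h1 : T -> R^o := fun x => Num.max (- a x) (Num.min (h x) (a x)).
have h1c : continuous h1.
  apply: continuous_maxr; last exact: continuous_minr.
  by move=> x; apply: cvgN; exact: ac.
have h2c : continuous (fun x => h x - h1 x : R^o).
  by move=> x; apply: cvgB; [exact: hc|exact: h1c].
have -> : h = fun x => h1 x + (h x - h1 x) by apply/funext => x; rewrite addrC subrK.
rewrite functionalD//; apply: lerD.
  apply: (@functional_variation_ub M) => // x Xx; first by have /andP[] := a0 x Xx.
  have /andP[? _] := a0 x Xx; rewrite /h1 ler_norml.
  by rewrite le_max lexx/= ge_max ge_min lexx orbT andbT; lra.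
apply: (@functional_variation_ub M) => // x Xx; first by have /andP[] := b0 x Xx.
have /andP[? _] := a0 x Xx; have /andP[? _] := b0 x Xx.
have := hab x Xx; rewrite /h1 !ler_norml => /andP[? ?].
by case: (leP (h x) (a x)) => ?; [case: (leP (- a x) (h x)) => ?|
  case: (leP (- a x) (a x)) => ?]; apply/andP; split; lra.
Qed.

Lemma functional_variation_geD M a b : bounded_nneg M a -> bounded_nneg M b ->
  functional_variation a + functional_variation b <= functional_variation (fun x => a x + b x).
Proof.
move=> [ac a0] [bc b0].
suff H h : continuous h -> (forall x, X x -> `|h x| <= b x) ->
    L h <= functional_variation (fun x => a x + b x) - functional_variation a.
  rewrite addrC -lerBrDr; apply: functional_variation_le => // x Xx.
  by have /andP[] := b0 x Xx.
move=> hc hb; rewrite lerBrDl -lerBrDr; apply: functional_variation_le => [x /a0/andP[]//|k kc ka].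
rewrite lerBrDr -functionalD//; apply: (@functional_variation_ub (M + M)) => [x Xx||x Xx].
- by have /andP[_ ?] := a0 x Xx; have /andP[_ ?] := b0 x Xx; rewrite lerD.
- by move=> x; apply: cvgD; [exact: kc|exact: hc].
- by apply: le_trans (ler_normD _ _) _; rewrite lerD ?ka ?hb.
Qed.

Lemma functional_variationD M a b : bounded_nneg M a -> bounded_nneg M b ->
  functional_variation (fun x => a x + b x) = functional_variation a + functional_variation b.
Proof.
move=> a0 b0; apply/eqP; rewrite eq_le (functional_variation_leD a0 b0).
by rewrite (functional_variation_geD a0 b0).
Qed.

Lemma bounded_nneg_max M a b : bounded_nneg M a -> bounded_nneg M b ->
  bounded_nneg M (fun x => Num.max (a x) (b x)).
Proof.
move=> [ac a0] [bc b0]; split=> [|x Xx].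
  exact: continuous_maxr.
have /andP[a0x aM] := a0 x Xx; have /andP[_ bM] := b0 x Xx.
by rewrite le_max ge_max a0x aM bM.
Qed.

Lemma bounded_nneg_min M a b : bounded_nneg M a -> bounded_nneg M b ->
  bounded_nneg M (fun x => Num.min (a x) (b x)).
Proof.
move=> [ac a0] [bc b0]; split=> [|x Xx].
  exact: continuous_minr.
have /andP[a0x aM] := a0 x Xx; have /andP[b0x _] := b0 x Xx.
by rewrite le_min ge_min a0x b0x aM.
Qed.

Lemma functional_variation_maxDmin M a b : bounded_nneg M a -> bounded_nneg M b ->
  functional_variation (fun x => Num.max (a x) (b x)) +
  functional_variation (fun x => Num.min (a x) (b x)) =
  functional_variation a + functional_variation b.
Proof.
move=> a0 b0; rewrite -(functional_variationD a0 b0) -(@functional_variationD M); last 2 first.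
- exact: bounded_nneg_max.
- exact: bounded_nneg_min.
congr functional_variation; apply/funext => x.
by case: (leP (a x) (b x)) => _; rewrite // addrC.
Qed.

End functional_variation_section.

(** * Grothendieck's theorem by iterated limits *)

Section double_limit.
Context (R : realType) (T1 T2 : topologicalType) (X : set T1) (Y : set T2).
Variables (L : (T1 -> R^o) -> R) (C : R).
Hypothesis C0 : 0 <= C.
Hypothesis Llin : forall (a : R) (f g : T1 -> R^o), continuous f -> continuous g ->
  L (fun x => a * f x + g x) = a * L f + L g.
Hypothesis Lle : forall (f : T1 -> R^o) (M : R), continuous f ->
  (forall x, X x -> `|f x| <= M) -> L f <= C * M.

Local Notation V := (functional_variation X L).
Local Notation bnn := (bounded_nneg X).
Local Notation minf f g := (fun x : T1 => Num.min (f x) (g x) : R^o).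

(** Functions of variation at least [c] that accumulate at [y0] cannot become
    almost disjoint: since the variation is additive on [max + min], the
    maximum of [p] almost disjoint ones has variation at least [p * (c / 2)],
    whereas it never exceeds [C * M]. *)
Lemma frequent_overlap (M c : R) (A O : set T2) (y0 : T2) (a : T2 -> T1 -> R^o) :
  0 <= M -> closure A y0 -> nbhs y0 O -> 0 < c ->
  (forall y, A y -> bnn M (a y) /\ c <= V (a y)) ->
  exists k, [/\ A k, O k & exists2 c' : R, 0 < c' &
    closure [set y | A y /\ c' <= V (minf (a k) (a y))] y0].
Proof.
move=> M0 Ay0 Oy0 c0 aP; apply: contrapT => noK.
have rare k : A k -> O k -> forall c' : R, 0 < c' ->
    \forall y \near y0, A y -> V (minf (a k) (a y)) < c'.
  move=> Ak Ok c' c'0; have : ~ closure [set y | A y /\ c' <= V (minf (a k) (a y))] y0.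
    by move=> cl; apply: noK; exists k; split=> //; exists c'.
  move=> /existsNP[U /not_implyP[Uy0 /set0P/negP/negPn/eqP U0]].
  apply: filterS Uy0 => y Uy Ay; rewrite ltNge; apply/negP => cV.
  by have : set0 y by rewrite -U0.
(* [f] is the maximum of [p] functions [a k], each chosen to overlap little
   with the maximum of the previous ones. *)
have grow p : exists f, [/\ bnn M f, p%:R * (c / 2) <= V f &
    forall c' : R, 0 < c' -> \forall y \near y0, A y -> V (minf f (a y)) < c'].
  elim: p => [|p [f [fM Vf fa]]].
    have V0 : V (fun=> 0) <= C * 0.
      by apply: functional_variation_bounded => // x _; rewrite lexx.
    exists (fun=> 0); split.
    - by split=> [x|x _]; [exact: cvg_cst|rewrite lexx].
    - rewrite mul0r; apply: le_trans (_ : L (fun=> 0) <= _).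
        by rewrite (functional0 Llin).
      apply: (functional_variation_ub (M := 0) Lle) => // x; first exact: cvg_cst.
      by rewrite normr0.
    - move=> c' c'0; near=> y => Ay; apply: le_lt_trans c'0.
      rewrite -[leRHS](mulr0 C); apply: functional_variation_bounded => // x Xx.
      have [[_ /(_ x Xx)/andP[ax _]] _] := aP y Ay.
      by rewrite le_min lexx ax ge_min lexx.
  have c20 : 0 < c / 2 by rewrite divr_gt0.
  have [k Ak [Ok /(_ Ak) Vk]] := closure_near Ay0 (filterI Oy0 (fa _ c20)).
  have [ak cVk] := aP k Ak.
  exists (fun x => Num.max (f x) (a k x)); split.
  - exact: bounded_nneg_max.
  - have := functional_variation_maxDmin Llin Lle fM ak.
    by rewrite -natr1 mulrDl mul1r; lra.
  - move=> c' c'0; have c'20 : 0 < c' / 2 by rewrite divr_gt0.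
    near=> y => Ay; have [ay _] := aP y Ay.
    have fay := bounded_nneg_min fM ay; have kay := bounded_nneg_min ak ay.
    apply: (@le_lt_trans _ _ (V (fun x => Num.min (f x) (a y x) + Num.min (a k x) (a y x)))).
      apply: (functional_variation_mono (M := M + M) Lle) => [x Xx|x Xx|x Xx].
      + by have [_ /(_ x Xx)/andP[]] := bounded_nneg_min (bounded_nneg_max fM ak) ay.
      + have [_ /(_ x Xx)/andP[? _]] := fay; have [_ /(_ x Xx)/andP[? _]] := kay.
        by case: (leP (f x) (a k x)) => _; rewrite ?lerDr ?lerDl.
      + by have [_ /(_ x Xx)/andP[_ ?]] := fay; have [_ /(_ x Xx)/andP[_ ?]] := kay;
          rewrite lerD.
    rewrite (functional_variationD Llin Lle fay kay) [ltRHS]splitr ltrD//.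
    + by apply: (near (fa _ c'20) y); last exact: Ay.
    + by apply: (near (rare _ Ak Ok _ c'20) y); last exact: Ay.
have CM0 : 0 <= C * M by rewrite mulr_ge0.
have [f [fM Vf _]] := grow (Num.bound (C * M / (c / 2))).+1.
have := le_trans Vf (functional_variation_bounded Lle fM.2).
rewrite -ler_pdivlMr ?divr_gt0// leNgt => /negP; apply.
have : 0 <= C * M / (c / 2) by rewrite !divr_ge0// ltW.
move/archi_boundP.
by move=> /lt_le_trans; apply; rewrite ler_nat.
Unshelve. all: by end_near. Qed.

Lemma functional_variation_gt0_ex (f : T1 -> R^o) : (forall x, X x -> 0 <= f x) ->
  0 < V f -> exists2 x, X x & 0 < f x.
Proof.
move=> f0 Vf; apply: contrapT => noX.
have : V f <= C * 0.
  apply: (functional_variation_bounded Lle) => x Xx; rewrite f0//= leNgt; apply/negP => fx.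
  by apply: noX; exists x.
by rewrite mulr0 leNgt Vf.
Qed.

(** One constructs [k_n] in [A] and [x_n] in [X] with [d <= |h (k_i) (x_n)|] for
    [i <= n] and [|h (k_n) (x_i)| < d / 2] for [i < n]; at cluster points of the
    two sequences the two families of inequalities contradict each other. The
    first family is kept alive by [frequent_overlap], applied to the functions
    [g y] that vanish where [|h y| <= d]: the minimum [Gs] of the [g (k_i)] keeps
    overlapping with [g y] for [y] in a set [As] that accumulates at [y0]. The
    second one holds because [k_n] is taken in a neighbourhood [Os] of [y0] on
    which [h y] is small at [x_i], [i < n]. *)
Lemma double_limit_contradiction (M e : R) (A : set T2) (y0 : T2) (h : T2 -> T1 -> R^o) :
  compact X -> compact Y -> A `<=` Y -> Y y0 -> closure A y0 ->
  (forall y, Y y -> continuous (h y)) ->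
  (forall x, X x -> continuous (fun y => h y x : R^o)) ->
  (forall x y, X x -> Y y -> `|h y x| <= M) ->
  (forall x, X x -> h y0 x = 0) -> 0 < e ->
  ~ (forall y, A y -> e <= L (h y)).
Proof.
move=> Xc Yc AY Yy0 Ay0 hc1 hc2 hM h0 e0 Lh.
(* The constant is such that cutting [|h y|] at height [d] costs at most
   [C * d <= e / 2] of variation. *)
pose d := e / (2 * (C + 1)).
have C1 : 0 < 2 * (C + 1) by rewrite mulr_gt0// ltr_wpDl.
have d0 : 0 < d by rewrite divr_gt0.
have Cd : C * d <= e / 2.
  rewrite /d mulrA ler_pdivrMr// mulrAC ler_pdivlMr//.
  by have := ltW e0; nra.
have [y1 Ay1 _] := closure_near Ay0 filterT.
pose g y x : R^o := Num.max (`|h y x| - d) 0.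
have gM y : Y y -> bnn M (g y).
  move=> Yy; split=> [|x Xx].
    apply: continuous_maxr => [x|x]; last exact: cvg_cst.
    by apply: cvgB; [exact: (continuous_abs (hc1 y Yy))|exact: cvg_cst].
  have hMx := hM x y Xx Yy; have M0 : 0 <= M := le_trans (normr_ge0 _) hMx.
  by rewrite le_max lexx orbT/= ge_max M0 andbT; lra.
have Vg y : A y -> e / 2 <= V (g y).
  move=> Ay; have Yy := AY y Ay.
  have [gc g0] := gM y Yy; have [dc dd] : bnn d (fun=> d).
    by split=> [x|x _]; [exact: cvg_cst|rewrite lexx ltW].
  have gMd : bnn (M + d) (g y).
    by split=> // x Xx; have /andP[-> gMx] := g0 x Xx; rewrite ler_wpDr// ltW.
  have M0 x : X x -> 0 <= M by move=> /(g0 x)/andP[? ?]; exact: le_trans (_ : g y x <= _).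
  have dMd : bnn (M + d) (fun=> d).
    by split=> // x Xx; rewrite ltW//= lerDr (M0 x).
  have := functional_variationD Llin Lle gMd dMd.
  have := functional_variation_bounded Lle dd.
  have : L (h y) <= V (fun x => g y x + d).
    apply: (functional_variation_ub (M := M + d) Lle); last 2 first.
    - exact: hc1.
    - by move=> x Xx; rewrite -lerBlDr /g le_max lexx.
    - by move=> x Xx; have /andP[_ ?] := g0 x Xx; rewrite lerD2r.
  by have := Lh y Ay; lra.
have [x1 Xx1 gx1] : exists2 x, X x & 0 < g y1 x.
  apply: functional_variation_gt0_ex.
    by move=> x Xx; have [_ /(_ x Xx)/andP[]] := gM y1 (AY _ Ay1).
  by apply: lt_le_trans (Vg y1 Ay1); rewrite divr_gt0.
have M0 : 0 <= M.
  by have [_ /(_ x1 Xx1)/andP[? ?]] := gM y1 (AY _ Ay1); exact: le_trans (_ : g y1 x1 <= _).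
pose St := ((T1 -> R^o) * set T2 * set T2 * T2 * T1)%type.
pose Gs (s : St) := s.1.1.1.1; pose As (s : St) := s.1.1.1.2.
pose Os (s : St) := s.1.1.2; pose ks (s : St) := s.1.2; pose xs (s : St) := s.2.
pose good (s : St) := [/\ bnn M (Gs s), closure (As s) y0, As s `<=` A,
  exists2 c : R, 0 < c & forall y, As s y -> c <= V (minf (Gs s) (g y)) & nbhs y0 (Os s)].
pose next (s s' : {s | good s}) := let: s := sval s in let: s' := sval s' in
  [/\ A (ks s'), Os s (ks s'), X (xs s'), Gs s' = minf (Gs s) (g (ks s')) &
    0 < Gs s' (xs s') /\ Os s' = Os s `&` [set y | `|h y (xs s')| < d / 2]].
have stepP (s : {s | good s}) : {s' | next s s'}.
  case: s => s sP; apply: cid; have [GM Acl AsA [c c0 cV] nO] := sP.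
  have [] := @frequent_overlap M c (As s) (Os s) y0 (fun y => minf (Gs s) (g y)) M0 Acl nO c0.
    move=> y Asy; split; last exact: cV.
    by apply: bounded_nneg_min => //; apply: gM; apply: AY; exact: AsA.
  move=> k [Ask Ok [c' c'0 cl]]; have Ak := AsA k Ask.
  pose G' := minf (Gs s) (g k).
  have G'M : bnn M G' by apply: bounded_nneg_min => //; apply: gM; exact: AY.
  have minE y : minf (minf (Gs s) (g k)) (minf (Gs s) (g y)) = minf G' (g y).
    by apply/funext => x; rewrite /G' -minA [X in Num.min _ X]minCA !minA minxx.
  have [z [Asz Vz] _] := closure_near cl filterT; rewrite minE in Vz.
  have G'z : bnn M (minf G' (g z)).
    by apply: bounded_nneg_min => //; apply: gM; apply: AY; exact: AsA.
  have [x Xx G'x] : exists2 x, X x & 0 < G' x.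
    apply: functional_variation_gt0_ex; first by move=> x Xx; have [_ /(_ x Xx)/andP[]] := G'M.
    apply: lt_le_trans c'0 (le_trans Vz _).
    apply: (functional_variation_mono (M := M) Lle) => x Xx.
    - by have [_ /(_ x Xx)/andP[]] := G'z.
    - by rewrite ge_min lexx.
    - by have [_ /(_ x Xx)/andP[]] := G'M.
  pose s' : St := (G', [set y | As s y /\ c' <= V (minf G' (g y))],
     Os s `&` [set y | `|h y x| < d / 2], k, x).
  have s'P : good s'.
    split=> //.
    - apply: closureS cl => y [Ay]; rewrite minE => Vy.
      by split.
    - by move=> y [/AsA].
    - by exists c' => // y [].
    - apply: filterI => //.
      have /(_ y0) := continuous_abs (hc2 x Xx); rewrite /continuous_at h0// normr0 => hx.
      have /hx : nbhs (0 : R^o) [set r | r < d / 2].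
        by apply: open_nbhs_nbhs; split; [exact: open_lt|rewrite /= divr_gt0].
      by [].
  by exists (exist _ s' s'P).
have s0P : good (fun=> M, A, setT, y1, x1).
  split=> //; last exact: filterT.
    by split=> [x|x _]; [exact: cvg_cst|rewrite lexx M0].
  exists (e / 2); first by rewrite divr_gt0.
  move=> y Ay; apply: le_trans (Vg y Ay) _.
  have gy := gM y (AY y Ay); apply: (functional_variation_mono (M := M) Lle) => x Xx.
  - by have [_ /(_ x Xx)/andP[]] := gy.
  - by have [_ /(_ x Xx)/andP[? ?]] := gy; rewrite le_min lexx andbT.
  - by rewrite ge_min lexx.
have [s_ [_ sS]] := dependent_choice stepP (exist _ _ s0P).
pose k n := ks (sval (s_ n.+1)); pose x n := xs (sval (s_ n.+1)).
have Ak n : A (k n) by have [] := sS n.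
have Xx n : X (x n) by have [] := sS n.
have Ggk i n t : (i <= n)%N -> Gs (sval (s_ n.+1)) t <= g (k i) t.
  elim: n => [|n IH].
    rewrite leqn0 => /eqP ->; have [_ _ _ -> _] := sS 0%N.
    by rewrite ge_min lexx orbT.
  rewrite leq_eqVlt ltnS => /predU1P[->|/IH le_n].
    by have [_ _ _ -> _] := sS n.+1; rewrite ge_min lexx orbT.
  by have [_ _ _ -> _] := sS n.+1; rewrite ge_min le_n.
have hge i n : (i <= n)%N -> d <= `|h (k i) (x n)|.
  move=> le_in; have [_ _ _ _ [G0 _]] := sS n.
  have := lt_le_trans G0 (Ggk i n _ le_in).
  by rewrite /g lt_max ltxx orbF subr_gt0 => /ltW.
have Osub i n y : (i < n)%N -> Os (sval (s_ n)) y -> `|h y (x i)| < d / 2.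
  elim: n => // n IH; rewrite ltnS leq_eqVlt => /predU1P[->|/IH le_n].
    by have [_ _ _ _ [_ ->]] := sS n; case.
  by have [_ _ _ _ [_ ->]] := sS n; case=> /le_n.
have hlt i n : (i < n)%N -> `|h (k n) (x i)| < d / 2.
  by move=> lt_in; apply: (Osub i n) => //; have [] := sS n.
have [xl Xxl xcl] := compact_seq_cluster Xc Xx.
have [yl Yyl ycl] := compact_seq_cluster Yc (fun n => AY _ (Ak n)).
have h1 i : d <= `|h (k i) xl|.
  apply: (cluster_closed (D := [set t | d <= `|h (k i) t|]) xcl).
    by apply: closed_preimage_ge; apply: continuous_abs; exact: hc1 (AY _ (Ak i)).
  by exists i => // n; exact: hge.
have h2 : d <= `|h yl xl|.
  apply: (cluster_closed (D := [set t | d <= `|h t xl|]) ycl).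
    by apply: closed_preimage_ge; apply: continuous_abs; exact: hc2.
  by exists 0%N => // n _; exact: h1.
have h3 i : `|h yl (x i)| <= d / 2.
  apply: (cluster_closed (D := [set t | `|h t (x i)| <= d / 2]) ycl).
    by apply: closed_preimage_le; apply: continuous_abs; exact: hc2.
  by exists i.+1 => // n; move=> /hlt/ltW.
have h4 : `|h yl xl| <= d / 2.
  apply: (cluster_closed (D := [set t | `|h yl t| <= d / 2]) xcl).
    by apply: closed_preimage_le; apply: continuous_abs; exact: hc1.
  by exists 0%N => // n _; exact: h3.
by lra.
Qed.

(** If continuity fails at [y0], then on a set accumulating at [y0] the number
    [L (B ^~ y) - L (B ^~ y0)] stays away from 0 with a constant sign, and
    [double_limit_contradiction] applies to [B ^~ y - B ^~ y0] up to that sign. *)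
Lemma functional_separately_continuous (M : R) (B : T1 -> T2 -> R^o) (y0 : T2) :
  compact X -> compact Y ->
  (forall y, Y y -> continuous (B ^~ y)) ->
  (forall x, X x -> continuous (B x)) ->
  (forall x y, X x -> Y y -> `|B x y| <= M) -> Y y0 ->
  forall e : R, 0 < e ->
  \forall y \near y0, Y y -> `|L (B ^~ y) - L (B ^~ y0)| < e.
Proof.
move=> Xc Yc Bc1 Bc2 BM Yy0 e e0; apply: contrapT => nnear.
pose A (b : bool) := [set y | Y y /\ e <= (-1) ^+ b * (L (B ^~ y) - L (B ^~ y0))].
have : closure (A false `|` A true) y0.
  move=> U Uy0; apply: contrapT => noq; apply: nnear.
  apply: filterS Uy0 => y Uy Yy; rewrite ltNge ler_normr; apply/negP => e_le.
  apply: noq; exists y; split=> //; case/orP: e_le => e_le; [left|right]; split=> //.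
    by rewrite expr0 mul1r.
  by rewrite expr1 mulN1r.
suff H b : ~ closure (A b) y0 by rewrite closureU => -[]; exact: H.
move=> Ab.
pose h y x : R^o := (-1) ^+ b * B x y + ((-1) ^+ (~~ b) * B x y0 + 0).
have hE y x : h y x = (-1) ^+ b * (B x y - B x y0).
  rewrite /h addr0 mulrBr; congr (_ + _).
  by case: b {Ab h}; rewrite !(expr0, expr1, mul1r, mulN1r)//= opprK.
have zc : continuous ((fun=> 0) : T1 -> R^o) by move=> x; exact: cvg_cst.
have By0c : continuous (fun x => (-1) ^+ (~~ b) * B x y0 + 0 : R^o).
  move=> x; apply: cvgD; last exact: cvg_cst.
  by apply: cvgMl_tmp; exact: Bc1.
apply: (@double_limit_contradiction (M + M) e (A b) y0 h) => //.
- by move=> y [].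
- move=> y Yy x; apply: cvgD; last exact: By0c.
  by apply: cvgMl_tmp; exact: Bc1.
- move=> x Xx y; apply: cvgD; last exact: cvg_cst.
  by apply: cvgMl_tmp; exact: Bc2.
- move=> x y Xx Yy; rewrite hE normrM normrX normrN normr1 expr1n mul1r.
  by apply: le_trans (ler_normB _ _) _; rewrite lerD// BM.
- by move=> x Xx; rewrite hE subrr mulr0.
- move=> y [Yy]; rewrite /h Llin//; last exact: Bc1.
  rewrite Llin//; last exact: Bc1.
  rewrite (functional0 Llin) addr0; congr (_ <= _); rewrite mulrBr; congr (_ + _).
  by case: b {Ab h hE By0c}; rewrite !(expr0, expr1, mul1r, mulN1r)//= opprK.
Qed.

End double_limit.

(** * The Hahn-Banach theorem *)

Section real_functionals.
Context (R : realType) (V : lmodType R) (f : V -> R^o).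
Hypothesis flin : linear f.

Lemma linear_funB x y : f (x - y) = (f x : R) - (f y : R).
Proof. by rewrite (addrC x) -scaleN1r flin scaleN1r (addrC _ (f x)). Qed.

Lemma linear_fun0 : f 0 = 0.
Proof. by rewrite -(subrr 0) linear_funB subrr. Qed.

Lemma linear_funN x : f (- x) = - (f x : R).
Proof. by rewrite -sub0r linear_funB linear_fun0 sub0r. Qed.

End real_functionals.

Section hahn_banach.
Context (R : realType) (V : lmodType R).
Implicit Types (p q : V -> R) (x y : V).

Definition sublinear q :=
  (forall x y, q (x + y) <= q x + q y) /\
  (forall (t : R) x, 0 < t -> q (t *: x) <= t * q x).

Lemma sublinearZ q (t : R) x : sublinear q -> 0 < t -> q (t *: x) = t * q x.
Proof.
move=> [_ qZ] t0; apply/eqP; rewrite eq_le qZ//= -ler_pdivlMl//.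
by rewrite -[in leLHS](scalerK (lt0r_neq0 t0) x) qZ ?invr_gt0.
Qed.

Lemma sublinear0 q : sublinear q -> q 0 = 0.
Proof.
move=> qs; have := @sublinearZ q 2 0 qs (ltr0n _ 2); rewrite scaler0; lra.
Qed.

Lemma sublinear_ge q x : sublinear q -> - q (- x) <= q x.
Proof.
by move=> qs; have := qs.1 x (- x); rewrite subrr sublinear0//; lra.
Qed.

(** Making [q] smaller so that it becomes odd at [y]: the new functional is
    at most [- q y] at [- y] and remains sublinear and below [q]. A minimal
    sublinear functional is therefore odd, that is, linear. *)
Definition sublinear_along q y x : R :=
  inf [set q (x + t *: y) - t * q y | t in [set t : R | 0 < t]].

Lemma sublinear_along_lb q y x (t : R) : sublinear q -> 0 < t ->
  - q (- x) <= q (x + t *: y) - t * q y.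
Proof.
move=> qs t0; rewrite -sublinearZ//.
by have := qs.1 (x + t *: y) (- x); rewrite addrAC subrr add0r; lra.
Qed.

Lemma sublinear_along_le q y x (t : R) : sublinear q -> 0 < t ->
  sublinear_along q y x <= q (x + t *: y) - t * q y.
Proof.
move=> qs t0; apply: ge_inf; last by exists t.
by exists (- q (- x)) => _ [s s0 <-]; exact: sublinear_along_lb.
Qed.

Lemma sublinear_along_ge q y x c :
  (forall t : R, 0 < t -> c <= q (x + t *: y) - t * q y) ->
  c <= sublinear_along q y x.
Proof.
move=> H; apply: lb_le_inf => [|_ [t t0 <-]]; last exact: H.
by exists (q (x + 1 *: y) - 1 * q y), 1 => //=; exact: ltr01.
Qed.

Lemma sublinear_along_sublinear q y :
  sublinear q -> sublinear (sublinear_along q y).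
Proof.
move=> qs; split=> [x z|t x t0].
  rewrite -lerBlDl; apply: sublinear_along_ge => s s0.
  rewrite lerBlDl -lerBlDr; apply: sublinear_along_ge => t t0.
  have := sublinear_along_le y (x + z) qs (addr_gt0 t0 s0).
  have := qs.1 (x + t *: y) (z + s *: y).
  by rewrite scalerDl addrACA; lra.
rewrite -ler_pdivrMl//; apply: sublinear_along_ge => s s0.
rewrite ler_pdivrMl//.
have := sublinear_along_le y (t *: x) qs (mulr_gt0 t0 s0).
by rewrite -scalerA -scalerDr (@sublinearZ q)//; lra.
Qed.

Lemma sublinear_along_le_id q y x : sublinear q -> sublinear_along q y x <= q x.
Proof.
move=> qs; have := sublinear_along_le y x qs ltr01.
by have := qs.1 x (1 *: y); rewrite scale1r mul1r; lra.
Qed.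

Lemma sublinear_alongN q y : sublinear q -> sublinear_along q y (- y) <= - q y.
Proof.
move=> qs; have := sublinear_along_le y (- y) qs ltr01.
by rewrite scale1r mul1r addNr sublinear0// sub0r.
Qed.

Lemma minimal_sublinear p : sublinear p -> exists2 q,
  sublinear q /\ (forall x, q x <= p x) &
  forall r, sublinear r -> (forall x, r x <= q x) -> r = q.
Proof.
move=> ps; pose T := {q | sublinear q /\ forall x, q x <= p x}.
pose rel (q r : T) := `[< forall x, sval r x <= sval q x >].
have [|q r s /asboolP qr /asboolP rs|[q qP] [r rP] /asboolP/= qr /asboolP/= rq|A Atot|q qmin]
    := @Zorn T rel.
- by move=> q; exact/asboolP.
- by apply/asboolP => x; exact: le_trans (rs x) (qr x).
- have e : q = r by apply/funext => x; apply/eqP; rewrite eq_le rq qr.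
  by subst r; congr exist; exact: Prop_irrelevance.
- have [[a0 Aa0]|A0] := pselect (exists a, A a); last first.
    exists (exist _ p (conj ps (fun=> lexx _))) => s As.
    by exfalso; apply: A0; exists s.
  pose m x := inf [set sval q x | q in A].
  have mlb x : has_lbound [set sval q x | q in A].
    exists (- p (- x)) => _ [[q [qs qp]] _ <-] /=.
    by apply: le_trans (sublinear_ge x qs); rewrite lerN2.
  have mle (q : T) x : A q -> m x <= sval q x.
    by move=> Aq; apply: ge_inf => //; exists q.
  have mge c x : (forall q : T, A q -> c <= sval q x) -> c <= m x.
    move=> H; apply: lb_le_inf => [|_ [q Aq <-]]; last exact: H.
    by exists (sval a0 x), a0.
  have ms : sublinear m.
    split=> [x z|t x t0].
      rewrite -lerBlDl; apply: (mge) => s As.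
      rewrite lerBlDl -lerBlDr; apply: (mge) => t At; rewrite lerBlDr.
      have [/asboolP st|/asboolP ts] := Atot _ _ As At.
        apply: le_trans (mle _ (x + z) At) _.
        by apply: le_trans ((svalP t).1.1 x z) _; rewrite lerD2l.
      apply: le_trans (mle _ (x + z) As) _.
      by apply: le_trans ((svalP s).1.1 x z) _; rewrite lerD2r.
    rewrite -ler_pdivrMl//; apply: (mge) => s As; rewrite ler_pdivrMl//.
    by apply: le_trans (mle _ _ As) _; exact: (svalP s).1.2.
  have mp x : m x <= p x by apply: le_trans (mle _ x Aa0) _; exact: (svalP a0).2.
  by exists (exist _ m (conj ms mp)) => s As; apply/asboolP => x; exact: mle.
exists (sval q); first exact: (svalP q).
move=> r rs rq; have rp x : r x <= p x by apply: le_trans (rq x) _; exact: (svalP q).2.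
by rewrite -(qmin (exist _ r (conj rs rp)))//; exact/asboolP.
Qed.

(** The minimization starts from [sublinear_along p v], whose value at [- v] is
    at most [- p v]: this is what pins down [f v]. *)
Theorem hahn_banach p v : sublinear p ->
  exists f : V -> R^o, [/\ linear f, forall x, f x <= p x & f v = p v].
Proof.
move=> ps; have [f [fs fle] fmin] :=
  minimal_sublinear (sublinear_along_sublinear v ps).
have fN y : f (- y) = - f y.
  apply/eqP; rewrite eq_le; apply/andP; split; last first.
    by have := sublinear_ge (- y) fs; rewrite opprK.
  rewrite -[f in leLHS](fmin (sublinear_along f y)).
  - exact: sublinear_alongN.
  - exact: sublinear_along_sublinear.
  - by move=> x; exact: sublinear_along_le_id.
have fD x y : f (x + y) = f x + f y.
  apply/eqP; rewrite eq_le fs.1/=.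
  by have := fs.1 (- x) (- y); rewrite -opprD !fN; lra.
have fZ (a : R) x : f (a *: x) = a * f x.
  have [a0|a0|->] := ltrgt0P a; last by rewrite scale0r mul0r sublinear0.
    exact: sublinearZ.
  have := @sublinearZ f (- a) x fs; rewrite oppr_gt0 scaleNr fN mulNr => /(_ a0).
  by move/oppr_inj.
exists f; split.
- by move=> a x y; rewrite fD fZ.
- by move=> x; apply: le_trans (fle x) _; exact: sublinear_along_le_id.
- apply/eqP; rewrite eq_le; apply/andP; split.
    by apply: le_trans (fle v) _; exact: sublinear_along_le_id.
  rewrite -lerN2 -fN; apply: le_trans (fle _) _; exact: sublinear_alongN.
Qed.

End hahn_banach.

(** * Norm fragmentability of weakly compact sets *)

Lemma cantor_bool (I : countType) (f : (nat -> bool) -> I) : ~ injective f.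
Proof.
move=> finj; pose b0 n := ~~ `[< exists2 b, pickle (f b) = n & b n >].
have [b0n|b0n] := boolP (b0 (pickle (f b0))).
  by move: (b0n) => /asboolP; apply; exists b0.
move: (b0n); rewrite negbK => /asboolP[b /(pcan_inj pickleK)/finj ->].
by apply/negP.
Qed.

Section seminorm.
Context (R : realType) (V : lmodType R) (N : V -> R).
Hypothesis ND : forall x y, N (x + y) <= N x + N y.
Hypothesis NZ : forall (a : R) x, N (a *: x) = `|a| * N x.

Lemma seminormN x : N (- x) = N x.
Proof. by rewrite -scaleN1r NZ normrN normr1 mul1r. Qed.

Lemma seminorm0 : N 0 = 0.
Proof. by rewrite -(scale0r 0) NZ normr0 mul0r. Qed.

Lemma seminorm_ge0 x : 0 <= N x.
Proof. by have := ND x (- x); rewrite subrr seminorm0 seminormN; lra. Qed.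

Lemma seminorm_sublinear : sublinear N.
Proof. by split=> // t x t0; rewrite NZ gtr0_norm. Qed.

Lemma seminorm_dist x y z : N (x - z) <= N (x - y) + N (y - z).
Proof. by rewrite -{1}(subrK y x) -addrA ND. Qed.

Lemma seminormB x y : N (x - y) = N (y - x).
Proof. by rewrite -opprB seminormN. Qed.

Lemma norming_functional v : exists f : V -> R^o, [/\ linear f, forall x, f x <= N x & f v = N v].
Proof. exact: hahn_banach seminorm_sublinear. Qed.

Section combinations.
Context (I : Type) (d : I -> V).

Definition combination (c : seq (R * I)) : V := \sum_(k <- c) k.1 *: d k.2.

Definition span_dist v : R := inf [set N (v - combination c) | c in setT].

Lemma combination_cat c c' : combination (c ++ c') = combination c + combination c'.
Proof. exact: big_cat. Qed.

Lemma combinationZ (a : R) c :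
  a *: combination c = combination [seq (a * k.1, k.2) | k <- c].
Proof.
rewrite /combination big_map scaler_sumr; apply: eq_bigr => k _.
by rewrite scalerA.
Qed.

Lemma span_dist_le v c : span_dist v <= N (v - combination c).
Proof.
apply: ge_inf; last by exists c.
by exists 0 => _ [k _ <-]; exact: seminorm_ge0.
Qed.

Lemma span_dist_ge v e : (forall c, e <= N (v - combination c)) -> e <= span_dist v.
Proof.
move=> H; apply: lb_le_inf => [|_ [c _ <-]]; last exact: H.
by exists (N (v - combination [::])), [::].
Qed.

Lemma span_dist_sublinear : sublinear span_dist.
Proof.
split=> [x y|t x t0].
  rewrite -lerBlDl; apply: span_dist_ge => c.
  rewrite lerBlDl -lerBlDr; apply: span_dist_ge => c'; rewrite lerBlDr.
  apply: le_trans (span_dist_le _ (c' ++ c)) _.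
  by rewrite combination_cat opprD addrACA ND.
rewrite -ler_pdivrMl//; apply: span_dist_ge => c; rewrite ler_pdivrMl//.
apply: le_trans (span_dist_le _ [seq (t * k.1, k.2) | k <- c]) _.
by rewrite -combinationZ -scalerBr NZ gtr0_norm.
Qed.

Lemma span_dist_gen a i : span_dist (a *: d i) <= 0.
Proof.
apply: le_trans (span_dist_le _ [:: (a, i)]) _.
by rewrite /combination big_seq1 subrr seminorm0.
Qed.

Lemma span_dist_le_norm v : span_dist v <= N v.
Proof.
by apply: le_trans (span_dist_le _ [::]) _; rewrite /combination big_nil subr0.
Qed.

Definition rat_combination (c : seq (rat * I)) : V :=
  combination [seq (ratr k.1, k.2) | k <- c].

Lemma rat_combination_approx (c : seq (R * I)) (e : R) : 0 < e ->
  exists c', N (combination c - rat_combination c') < e.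
Proof.
elim: c e => [|[a i] c IH] e e0.
  by exists [::]; rewrite subrr seminorm0.
have [c' c'e] := IH (e / 2) (divr_gt0 e0 (ltr0n _ 2)).
have Nd0 : 0 < N (d i) + 1 by rewrite ltr_wpDl// seminorm_ge0.
have [|q] := @rat_in_itvoo R a (a + e / 2 / (N (d i) + 1)).
  by rewrite ltrDl !divr_gt0.
rewrite in_itv/= => /andP[aq qa].
exists ((q, i) :: c'); rewrite /rat_combination /= /combination !big_cons/=.
rewrite opprD addrACA -scalerBl; apply: le_lt_trans (ND _ _) _.
rewrite [ltRHS]splitr; apply: ler_ltD; last exact: c'e.
rewrite NZ distrC gtr0_norm ?subr_gt0//.
rewrite -ltrBlDl in qa; have := ltW qa; rewrite ler_pdivlMr// => qae.
apply: le_trans qae; rewrite ler_wpM2l ?lerDl// subr_ge0 ltW//.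
Qed.

End combinations.

Section fragmentability.
Context (X : topologicalType) (j : X -> V).
Hypothesis jc : forall f : V -> R^o, linear f -> (forall x, f x <= N x) ->
  continuous (f \o j).

(** A form of Mazur's theorem. A functional dominated by the distance to the
    span of [D] vanishes on [D], hence on its closure; by Hahn-Banach that
    distance vanishes at [x]. Rational coefficients make the set of combinations
    countable when [I] is. *)
Lemma closure_rat_combination (I : Type) (D : I -> X) x (e : R) :
  closure (range D) x -> 0 < e ->
  exists c, N (j x - rat_combination (j \o D) c) < e.
Proof.
move=> xD e0.
have [f [fl fle fx]] := hahn_banach (j x) (span_dist_sublinear (j \o D)).
have fN := linear_funN fl.
have f0 i : f (j (D i)) = 0.
  apply/eqP; rewrite eq_le; apply/andP; split.
    by apply: le_trans (fle _) _; have := span_dist_gen (j \o D) 1 i; rewrite scale1r.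
  rewrite -oppr_le0 -fN; apply: le_trans (fle _) _.
  by have := span_dist_gen (j \o D) (-1) i; rewrite scaleN1r.
have fjc : continuous (f \o j).
  by apply: jc => // y; apply: le_trans (fle y) _; exact: span_dist_le_norm.
have fjx : f (j x) <= 0.
  have : closed [set y | (f \o j) y <= 0] by exact: closed_preimage_le.
  apply; apply: closureS xD => _ [i _ <-] /=; by rewrite f0.
rewrite fx in fjx.
have [c xc] : exists c, N (j x - combination (j \o D) c) < e / 2.
  apply: contrapT => noc; suff : e / 2 <= 0 by rewrite leNgt divr_gt0.
  apply: le_trans fjx; apply: span_dist_ge => c; rewrite leNgt; apply/negP => ce.
  by apply: noc; exists c.
have [c' cc'] := rat_combination_approx (j \o D) c (divr_gt0 e0 (ltr0n _ 2)).
exists c'; apply: le_lt_trans (seminorm_dist _ (combination (j \o D) c) _) _.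
by rewrite [ltRHS]splitr ltrD.
Qed.

Variables (F : set X) (e : R).
Hypothesis Fc : compact F.
Hypothesis F0 : F !=set0.
Hypothesis e0 : 0 < e.

Definition relopen (U : set X) := open U /\ F `&` U !=set0.

(** Two slices of [U] cut by a functional that norms [j x - j y]; the gap [r]
    left on both sides makes the separation survive in the closures. *)
Lemma split_relopen U x y : relopen U -> F x -> U x -> F y -> U y ->
  e < N (j x - j y) -> exists U0 U1, [/\ relopen U0, relopen U1, U0 `<=` U, U1 `<=` U &
    forall u v, closure U0 u -> closure U1 v -> e <= N (j u - j v)].
Proof.
move=> [Uo _] Fx Ux Fy Uy exy.
have [f [fl fle fxy]] := norming_functional (j x - j y).
have fB := linear_funB fl.
have fjc : continuous (f \o j) by exact: jc.
pose r := (N (j x - j y) - e) / 2.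
have r0 : 0 < r by rewrite divr_gt0// subr_gt0.
have rE : N (j x - j y) = e + r + r by rewrite /r; lra.
rewrite fB in fxy.
pose U0 := U `&` [set u | f (j x) - r < f (j u)].
pose U1 := U `&` [set u | f (j u) < f (j y) + r].
exists U0, U1; split.
- split; last by exists x; split=> //; split=> //=; lra.
  apply: openI => //; apply: (@open_comp _ _ (f \o j) [set t | f (j x) - r < t]).
    by move=> z _; exact: fjc.
  exact: open_gt.
- split; last by exists y; split=> //; split=> //=; lra.
  apply: openI => //; apply: (@open_comp _ _ (f \o j) [set t | t < f (j y) + r]).
    by move=> z _; exact: fjc.
  exact: open_lt.
- by move=> u [].
- by move=> u [].
- move=> u v U0u U1v; apply: le_trans (fle _); rewrite fB.
  have uE : f (j x) - r <= f (j u).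
    apply: (closed_preimage_ge (c := f (j x) - r) fjc).
    by apply: closureS U0u => z [_ /ltW].
  have vE : f (j v) <= f (j y) + r.
    apply: (closed_preimage_le (c := f (j y) + r) fjc).
    by apply: closureS U1v => z [_ /ltW].
  by lra.
Qed.

(** Otherwise repeated splitting gives a dyadic tree of open sets. With a point
    [D s] in each of them, a cluster point along every branch yields a family
    of points indexed by [nat -> bool] whose mutual distances are at least [e].
    All of them lie in the closure of the countable set of the [D s], hence at
    distance less than [e / 2] from countably many rational combinations, which
    Cantor's theorem forbids. *)
Theorem fragmented : exists2 U, relopen U &
  forall x y, F x -> U x -> F y -> U y -> N (j x - j y) <= e.
Proof.
apply: contrapT => nofrag.
pose RO := {U | relopen U}.
have splitP (U : RO) : {W : RO * RO | [/\ sval W.1 `<=` sval U, sval W.2 `<=` sval U &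
    forall u v, closure (sval W.1) u -> closure (sval W.2) v -> e <= N (j u - j v)]}.
  apply: cid; case: U => U roU.
  have [x [y [Fx Ux Fy [Uy exy]]]] : exists x y, [/\ F x, U x, F y & U y /\ e < N (j x - j y)].
    apply: contrapT => noxy; apply: nofrag; exists U => // x y Fx Ux Fy Uy.
    by rewrite leNgt; apply/negP => exy; apply: noxy; exists x, y.
  have [U0 [U1 [ro0 ro1 U0U U1U sep]]] := split_relopen roU Fx Ux Fy Uy exy.
  by exists (exist _ U0 ro0, exist _ U1 ro1).
have roT : relopen setT by split; [exact: openT|rewrite setIT].
pose node := fix node (s : seq bool) : RO := if s is b :: s' then
  let W := sval (splitP (node s')) in if b then W.2 else W.1 else exist _ _ roT.
pose D s : X := sval (cid (svalP (node s)).2).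
have DP s : F (D s) /\ sval (node s) (D s) by exact: (svalP (cid (svalP (node s)).2)).
pose pre (b : nat -> bool) := fix pre n := if n is n'.+1 then b n' :: pre n' else [::].
have node_sub b n m : (n <= m)%N -> sval (node (pre b m)) `<=` sval (node (pre b n)).
  elim: m => [|m IH]; first by rewrite leqn0 => /eqP ->.
  rewrite leq_eqVlt ltnS => /predU1P[->//|/IH]; apply: subset_trans => /=.
  by have [] := svalP (splitP (node (pre b m))); case: ifP.
have xP b := compact_seq_cluster Fc (fun n => (DP (pre b n)).1).
pose x b := s2val (cid2 (xP b)).
have xD b : closure (range D) (x b).
  apply: (cluster_closed (s2valP' (cid2 (xP b)))); first exact: closed_closure.
  by exists 0%N => // n _; apply: subset_closure; exists (pre b n).
have xnode b n : closure (sval (node (pre b n))) (x b).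
  apply: (cluster_closed (s2valP' (cid2 (xP b)))); first exact: closed_closure.
  exists n => // m nm; apply: subset_closure.
  by apply: (node_sub _ _ _ nm); exact: (DP _).2.
have xsep b b' n : pre b n = pre b' n -> b n = false -> b' n = true -> e <= N (j (x b) - j (x b')).
  move=> pE bn b'n; have := xnode b' n.+1; have := xnode b n.+1.
  rewrite /= -pE bn b'n => xb xb'.
  by have [_ _] := svalP (splitP (node (pre b n))); apply.
have e20 : 0 < e / 2 by rewrite divr_gt0.
pose c b := sval (cid (closure_rat_combination (xD b) e20)).
have cP b : N (j (x b) - rat_combination (j \o D) (c b)) < e / 2.
  exact: (svalP (cid (closure_rat_combination (xD b) e20))).
apply: (@cantor_bool _ c) => b b' cE.
have near_bb' : N (j (x b) - j (x b')) < e.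
  apply: le_lt_trans (seminorm_dist _ (rat_combination (j \o D) (c b)) _) _.
  by rewrite [ltRHS]splitr ltrD ?cP// seminormB cE cP.
have pE n : pre b n = pre b' n.
  elim: n => //= n IH; congr cons => //.
  case bn : (b n); case b'n : (b' n) => //.
    by have := xsep b' b n (esym IH) b'n bn; rewrite seminormB leNgt near_bb'.
  by have := xsep b b' n IH bn b'n; rewrite leNgt near_bb'.
by apply/funext => n; have /= [] := pE n.+1.
Qed.

End fragmentability.
End seminorm.

(** * Pointwise topology, minimal closed sets and idempotents *)

Section pointwise_topology.

Lemma ptws_eval_continuous (I : Type) (T : topologicalType) (i : I) :
  continuous (fun f : {ptws I -> T} => f i).
Proof.
move=> f U fU; have /cvg_sup/(_ i) : f --> f by exact: cvg_id.
apply; exact: (@initial_continuous _ _ (fun g : forall _ : I, T => g i)).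
Qed.

Lemma continuous_ptws (Z : topologicalType) (I : Type) (T : topologicalType)
  (f : Z -> {ptws I -> T}) :
  (forall i, continuous (fun z => f z i)) -> continuous f.
Proof.
move=> fc z; apply/cvg_sup => i.
exact: (@continuous_comp_initial _ _ _ (fun g : forall _ : I, T => g i) f (fc i) z).
Qed.

Lemma separated_hausdorff (T : topologicalType) :
  (forall x y : T, x <> y -> exists (U : topologicalType) (f : T -> U),
    [/\ hausdorff_space U, continuous f & f x <> f y]) -> hausdorff_space T.
Proof.
move=> sep x y xy; apply: contrapT => /sep[U [f [hU fc]]]; apply.
apply: hU => A B fA fB; have [z [Az Bz]] := xy _ _ (fc x A fA) (fc y B fB).
by exists (f z).
Qed.

Lemma hausdorff_ptws (I : Type) (T : topologicalType) :
  hausdorff_space T -> hausdorff_space {ptws I -> T}.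
Proof.
move=> hT; apply: separated_hausdorff => f g fg.
have [i fgi] : exists i, f i <> g i.
  by apply: contrapT => nofg; apply: fg; apply/funext => i; apply: contrapT => fgi;
    apply: nofg; exists i.
by exists T, (fun h : {ptws I -> T} => h i); split=> //; exact: ptws_eval_continuous.
Qed.

End pointwise_topology.

Section minimal_closed_sets.
Context {T : topologicalType}.

Lemma directed_bigcap (I : Type) (D : set I) (f : I -> set T) (K : set T) :
  compact K -> D !=set0 ->
  (forall i, D i -> [/\ closed (f i), f i `<=` K & f i !=set0]) ->
  (forall i k, D i -> D k -> exists2 l, D l & f l `<=` f i `&` f k) ->
  \bigcap_(i in D) f i !=set0.
Proof.
move=> Kc [i0 Di0] fP fdir.
have fF : Filter (filter_from D f) by apply: filter_from_filter; [exists i0|].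
have fPF : ProperFilter (filter_from D f).
  by apply: filter_from_proper => i /fP[].
have [|x [Kx xcl]] := Kc (filter_from D f) fPF.
  by exists i0 => //; have [] := fP i0 Di0.
exists x => i Di; apply: (cluster_closed xcl); last by exists i.
by have [] := fP i Di.
Qed.

(** Zorn's lemma for nonempty closed subsets of a compact set; compactness
    keeps the intersection of a chain nonempty. *)
Lemma minimal_closed (P : set (set T)) (C0 : set T) :
  compact C0 -> closed C0 -> C0 !=set0 -> P C0 ->
  (forall G : set (set T), G !=set0 -> G `<=` P -> P (\bigcap_(C in G) C)) ->
  exists C, [/\ C `<=` C0, closed C, C !=set0, P C &
    forall D, D `<=` C -> closed D -> D !=set0 -> P D -> D = C].
Proof.
move=> C0c C0cl C00 PC0 Pcap.
pose good C := [/\ C `<=` C0, closed C, C !=set0 & P C].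
pose rel (C D : {C | good C}) := `[< sval D `<=` sval C >].
have [|C D E /asboolP CD /asboolP DE|[C CP] [D DP] /asboolP/= CD /asboolP/= DC|A Atot|C Cmin]
    := @Zorn _ rel.
- by move=> C; apply/asboolP.
- by apply/asboolP; exact: subset_trans DE CD.
- have e : C = D by apply/seteqP.
  by subst D; congr exist; exact: Prop_irrelevance.
- have [A0|A0] := pselect (A !=set0); last first.
    have C0P : good C0 by split.
    by exists (exist _ C0 C0P) => s As; exfalso; apply: A0; exists s.
  have [x xA] : \bigcap_(C in A) sval C !=set0.
    apply: (directed_bigcap C0c) => // [C AC|C D AC AD].
      by have [] := svalP C.
    have [/asboolP DC|/asboolP CD] := Atot C D AC AD.
      by exists D => // z Dz; split=> //; exact: DC.
    by exists C => // z Cz; split=> //; exact: CD.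
  have capE : \bigcap_(C in A) sval C = \bigcap_(C in [set sval C | C in A]) C.
    by rewrite bigcap_image.
  have capP : good (\bigcap_(C in A) sval C).
    split.
    - by have [C AC] := A0 => z /(_ C AC); have [+ _ _ _] := svalP C; apply.
    - by apply: closed_bigI => C _; have [] := svalP C.
    - by exists x.
    - rewrite capE; apply: Pcap; first by have [C AC] := A0; exists (sval C), C.
      by move=> _ [C AC <-]; have [] := svalP C.
  by exists (exist _ _ capP) => C AC; apply/asboolP => z; exact.
exists (sval C); have [CC0 Ccl Cn0 PC] := svalP C; split=> // D DC Dcl D0 PD.
have DP : good D by split=> //; exact: subset_trans CC0.
by rewrite -(Cmin (exist _ D DP))//; exact/asboolP.
Qed.

End minimal_closed_sets.

Section ellis.
Context (X : topologicalType).
Hypothesis Xh : hausdorff_space X.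
Local Notation XX := {ptws X -> X}.

(** For [r] in a minimal closed subsemigroup [E] one has [E r = E], so that
    [t r = r] for some [t] in [E]; the [t] with this property form a closed
    subsemigroup, which is then all of [E] and contains [r] itself. *)
Lemma ellis_idempotent (M : set XX) : compact M -> M !=set0 ->
  (forall f g, M f -> M g -> M (f \o g)) -> exists2 e, M e & e \o e = e.
Proof.
move=> Mc M0 Mcomp; have XXh := @hausdorff_ptws X X Xh.
have [||E [EM Ecl [r Er] Ecomp Emin]] := @minimal_closed XX
   [set C : set XX | forall f g, C f -> C g -> C (f \o g)] M Mc _ M0 Mcomp.
- exact: compact_closed.
- by move=> G _ GP f g Gf Gg C GC; apply: (GP C GC); [exact: Gf|exact: Gg].
have compr_c : continuous ((fun f => f \o r) : XX -> XX).
  by apply: continuous_ptws => x; exact: ptws_eval_continuous.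
have Ec : compact E by apply: subclosed_compact Mc EM.
have ErE : [set (f \o r : XX) | f in E] = E.
  apply: Emin.
  - by move=> _ [f Ef <-]; exact: Ecomp.
  - apply: compact_closed => //; apply: continuous_compact Ec.
    exact: continuous_subspaceT.
  - by exists (r \o r), r.
  - move=> _ _ [f Ef <-] [g Eg <-]; exists (f \o (r \o g)) => //.
    by apply: (Ecomp) => //; exact: Ecomp.
have [t Et tr] : [set (f \o r : XX) | f in E] r by rewrite ErE.
have WE : E `&` [set f : XX | f \o r = r] = E.
  apply: Emin.
  - by move=> f [].
  - apply: closedI => //.
    apply: (@preimage_closed _ _ ((fun f => f \o r) : XX -> XX) [set r]).
      by move=> x _; exact: compr_c.
    exact: accessible_closed_set1 (hausdorff_accessible XXh) _.
  - by exists t.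
  - move=> f g [Ef /= fr] [Eg /= gr]; split; first exact: Ecomp.
    by rewrite /= -compA gr.
have [_ rr] : (E `&` [set f : XX | f \o r = r]) r by rewrite WE.
by exists r => //; exact: EM.
Qed.

End ellis.

(** * Common fixed points of nonexpansive actions *)

Lemma subr_midpoint (R : realType) (V : lmodType R) (x y z : V) :
  x - 2^-1 *: (y + z) = 2^-1 *: (x - y) + 2^-1 *: (x - z).
Proof.
have h : 2^-1 + 2^-1 = 1 :> R by lra.
rewrite -scalerDr addrACA -opprD scalerBr; congr (_ - _).
by rewrite scalerDr -scalerDl h scale1r.
Qed.

Section common_fixed_point.
Context (R : realType) (V : lmodType R) (N : V -> R).
Hypothesis ND : forall x y, N (x + y) <= N x + N y.
Hypothesis NZ : forall (a : R) x, N (a *: x) = `|a| * N x.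
Hypothesis N_eq0 : forall x, N x = 0 -> x = 0.
Context (X : topologicalType) (j : X -> V).
Hypothesis jc : forall f : V -> R^o, linear f -> (forall x, f x <= N x) ->
  continuous (f \o j).
Hypothesis jinj : injective j.
Hypothesis Xc : compact [set: X].
Hypothesis Xmid : forall x y, exists z, j z = 2^-1 *: (j x + j y).

Local Notation dist x y := (N (j x - j y)).
Local Notation XX := {ptws X -> X}.

Lemma functional_separates x y : x <> y -> exists f : V -> R^o,
  [/\ linear f, forall v, f v <= N v & f (j x) <> f (j y)].
Proof.
move=> xy; have [f [fl fle fxy]] := norming_functional ND NZ (j x - j y).
exists f; split=> // fE; apply: xy; apply: jinj; apply/eqP; rewrite -subr_eq0.
by apply/eqP; apply: N_eq0; rewrite -fxy linear_funB// fE subrr.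
Qed.

(** The norm is a supremum of continuous functionals, hence lower
    semicontinuous for the topology of [X]. *)
Lemma dist_le_closed x c : closed [set y | dist x y <= c].
Proof.
have -> : [set y | dist x y <= c] =
    \bigcap_(f in [set f : V -> R^o | linear f /\ forall v, f v <= N v])
      [set y | f (j x) - c <= f (j y)].
  apply/seteqP; split=> y /=.
    move=> xyc f [fl fle]; have := fle (j x - j y).
    by rewrite linear_funB//=; move: xyc; lra.
  move=> H; have [f [fl fle <-]] := norming_functional ND NZ (j x - j y).
  by have := H f (conj fl fle); rewrite /= linear_funB//; lra.
by apply: closed_bigI => f [fl fle]; exact: closed_preimage_ge (jc fl fle).
Qed.

Lemma space_hausdorff : hausdorff_space X.
Proof.
apply: separated_hausdorff => x y /functional_separates[f [fl fle fxy]].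
by exists R^o, (f \o j); split; [exact: norm_hausdorff|exact: jc|].
Qed.

Context (S : semigroupType) (act : S -> X -> X).
Hypothesis actM : forall s t x, act s (act t x) = act (s * t)%g x.
Hypothesis act_quasi : forall g : XX, closure (range (act : S -> XX)) g ->
  continuous (g : X -> X).
Hypothesis act_nonexp : forall s x y, dist (act s x) (act s y) <= dist x y.
Hypothesis S0 : [set: S] !=set0.

(** The enveloping semigroup of the action. *)
Definition envelope : set XX := closure (range (act : S -> XX)).

Lemma envelope_act s : envelope (act s).
Proof. by apply: subset_closure; exists s. Qed.

Lemma act_continuous s : continuous (act s).
Proof. exact/act_quasi/envelope_act. Qed.

Lemma envelope_closed : closed envelope.
Proof. exact: closed_closure. Qed.

Lemma ptws_compact : compact [set: XX].
Proof.
have := @tychonoff X (fun=> X) (fun=> setT) (fun=> Xc).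
by congr compact; apply/seteqP; split.
Qed.

Lemma envelope_compact : compact envelope.
Proof. by apply: subclosed_compact ptws_compact _ => //; exact: envelope_closed. Qed.

Lemma envelope_ind (P : set XX) : closed P -> (forall s, P (act s)) -> envelope `<=` P.
Proof.
move=> Pcl Pact; rewrite [P](closure_id _).1//.
by apply: closureS => _ [s _ <-].
Qed.

Lemma envelope_comp f g : envelope f -> envelope g -> envelope (f \o g).
Proof.
move=> Ef Eg; move: f Ef.
have compr_c : continuous ((fun f => f \o g) : XX -> XX).
  by apply: continuous_ptws => x; exact: ptws_eval_continuous.
apply: (envelope_ind (P := [set f : XX | envelope (f \o g)])).
  apply: (@preimage_closed _ _ ((fun f => f \o g) : XX -> XX) envelope).
    by move=> x _; exact: compr_c.
  exact: envelope_closed.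
move=> s; move: g Eg {compr_c}.
have compl_c : continuous ((fun g => act s \o g) : XX -> XX).
  apply: continuous_ptws => x g /=.
  apply: (@continuous_comp XX X X (fun g => g x) (act s)).
    exact: ptws_eval_continuous.
  exact: act_continuous.
apply: (envelope_ind (P := [set g : XX | envelope (act s \o g)])).
  apply: (@preimage_closed _ _ ((fun g => act s \o g) : XX -> XX) envelope).
    by move=> x _; exact: compl_c.
  exact: envelope_closed.
move=> t /=; have -> : act s \o act t = act (s * t)%g by apply/funext => x; exact: actM.
exact: envelope_act.
Qed.

Lemma envelope_nonexp f x y : envelope f -> dist (f x) (f y) <= dist x y.
Proof.
move: f; apply: (envelope_ind (P := [set f : XX | dist (f x) (f y) <= dist x y])) => [|s].
  2: exact: act_nonexp.
have -> : [set f : XX | dist (f x) (f y) <= dist x y] =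
    \bigcap_(h in [set h : V -> R^o | linear h /\ forall v, h v <= N v])
      [set f : XX | (h (j (f x)) : R) - h (j (f y)) <= dist x y].
  apply/seteqP; split=> f /= fxy.
    move=> h [hl hle] /=; apply: le_trans fxy.
    by have := hle (j (f x) - j (f y)); rewrite (linear_funB hl).
  have [h [hl hle <-]] := norming_functional ND NZ (j (f x) - j (f y)).
  by have := fxy h (conj hl hle); rewrite /= (linear_funB hl).
apply: closed_bigI => h [hl hle]; apply: closed_preimage_le.
have hc z : continuous ((fun f => h (j (f z))) : XX -> R^o).
  move=> f; apply: (@continuous_comp XX X R^o (fun f => f z) (h \o j)).
    exact: ptws_eval_continuous.
  exact: jc.
by move=> f; exact: (cvgB (hc x f) (hc y f)).
Qed.

Definition invariant (C : set X) := forall s x, C x -> C (act s x).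

Definition midconvex (C : set X) :=
  forall x y z, C x -> C y -> j z = 2^-1 *: (j x + j y) -> C z.

Lemma envelope_invariant (C : set X) f x : closed C -> invariant C ->
  envelope f -> C x -> C (f x).
Proof.
move=> Ccl Ci Ef Cx; move: f Ef.
apply: (envelope_ind (P := [set f : XX | C (f x)])) => [|s]; last exact: Ci.
apply: (@preimage_closed _ _ (fun f : XX => f x) C) => // f _.
exact: ptws_eval_continuous.
Qed.

Section minimal_set.
Variable F : set X.
Hypothesis F0 : F !=set0.
Hypothesis Fcl : closed F.
Hypothesis Finv : invariant F.
Hypothesis Fmin : forall C, C `<=` F -> closed C -> C !=set0 -> invariant C -> C = F.

Section mean.
Variable L : (X -> R^o) -> R.
Hypothesis Llin : forall (a : R) (f g : X -> R^o), continuous f -> continuous g ->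
  L (fun x => a * f x + g x) = a * L f + L g.
Hypothesis Lle : forall (f : X -> R^o) (M : R), continuous f ->
  (forall x, F x -> `|f x| <= M) -> L f <= M.
Hypothesis L1 : L (fun=> 1) = 1.
Hypothesis Linv : forall s (f : X -> R^o), continuous f -> L (f \o act s) = L f.

Let cstc (c : R) : continuous ((fun=> c) : X -> R^o).
Proof. by move=> x; exact: cvg_cst. Qed.

Lemma mean_cst (c : R) : L (fun=> c) = c.
Proof.
have -> : ((fun=> c) : X -> R^o) = (fun x => c * (1 : R^o) + 0).
  by apply/funext => x; rewrite [c * _]mulr1 addr0.
rewrite (Llin c (@cstc 1) (@cstc 0)) (functional0 Llin) L1.
by rewrite [c * _]mulr1 addr0.
Qed.

Lemma mean_ge (f : X -> R^o) (c : R) : continuous f -> (forall x, F x -> c <= f x) -> c <= L f.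
Proof.
move=> fc cf.
have Fc : compact F by apply: subclosed_compact Xc _.
have [M [_ /(_ (M + 1))]] := compact_bounded (continuous_compact (continuous_subspaceT fc) Fc).
rewrite ltrDl ltr01 => /(_ isT) fM.
have := @Lle (fun x => -1 * f x + (M + 1)) (M + 1 - c).
rewrite (Llin (-1) fc (@cstc (M + 1))) mean_cst => H; suff : -1 * L f + (M + 1) <= M + 1 - c by lra.
apply: H => [x|x Fx].
  by apply: cvgD; [apply: cvgMl_tmp; exact: fc|exact: cvg_cst].
have := fM (f x) (imageP _ Fx); rewrite /= ler_norml => /andP[? ?].
have ? := cf x Fx; rewrite ger0_norm; rewrite mulN1r; first by rewrite addrC lerD2l lerN2.
by rewrite addrC subr_ge0.
Qed.

(** The common zeros in [F] of the nonnegative functions of mean 0 form a closed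
    invariant set. It is nonempty by compactness, because a function bounded
    below by a positive constant on [F] has positive mean; so it is [F]. *)
Lemma minimal_mean_faithful (u : X -> R^o) : continuous u -> (forall x, 0 <= u x) -> L u = 0 ->
  forall x, F x -> u x = 0.
Proof.
move=> uc u0 Lu x Fx; apply/eqP; rewrite eq_le u0 andbT.
pose D := [set ue : (X -> R^o) * R | [/\ continuous ue.1, forall x, 0 <= ue.1 x,
  L ue.1 = 0 & 0 < ue.2]].
pose Z (ue : (X -> R^o) * R) := F `&` [set y | ue.1 y <= ue.2].
have Zcl ue : D ue -> closed (Z ue).
  by move=> [uec _ _ _]; apply: closedI => //; exact: closed_preimage_le.
have ZF : \bigcap_(ue in D) Z ue = F.
  apply: Fmin.
  - by move=> y /(_ (u, 1)); case=> //; split=> //=; exact: ltr01.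
  - by apply: closed_bigI => ue; exact: Zcl.
  - apply: (directed_bigcap (K := F)).
    + by apply: subclosed_compact Xc _.
    + by exists (u, 1); split=> //=; exact: ltr01.
    + move=> ue Due; split; [exact: Zcl|by move=> y []|].
      apply: contrapT => Z0; case: Due => uec ue0 Lue ue2.
      have : ue.2 <= L ue.1.
        apply: mean_ge => // y Fy; rewrite leNgt; apply/negP => uey.
        by apply: Z0; exists y; split=> //; exact: ltW.
      by rewrite Lue leNgt ue2.
    + move=> [u1 e1] [u2 e2] [/= u1c u10 Lu1 e10] [/= u2c u20 Lu2 e20].
      exists (fun x => 1 * u1 x + u2 x, Num.min e1 e2); first split=> /=.
      * by move=> y; apply: cvgD; [apply: cvgMl_tmp; exact: u1c|exact: u2c].
      * by move=> y; rewrite mul1r addr_ge0.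
      * by rewrite Llin// Lu1 Lu2 mulr0 addr0.
      * by rewrite lt_min e10 e20.
      * move=> y [Fy] /=; rewrite le_min => /andP[h1 h2].
        have := u10 y; have := u20 y; rewrite mul1r in h1 h2 => ? ?.
        split; split=> //=.
          by apply: le_trans h1; rewrite lerDl.
        by apply: le_trans h2; rewrite lerDr.
  - move=> s y Zy [v e] [/= vc v0 Lv e0].
    have := Zy (v \o act s, e); case.
      split=> //=; first exact: (fun x => continuous_comp (@act_continuous s x) (vc _)).
      by rewrite Linv.
    by move=> Fy vy; split=> //; exact: Finv.
rewrite -(ZF) in Fx.
rewrite leNgt; apply/negP => ux; have := Fx (u, u x / 2); case.
  by split=> //=; rewrite divr_gt0.
by move=> _ /=; lra.
Qed.

(** The function [(x, g) |-> u (g x)] is separately continuous on [X] times the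
    envelope, so that the invariance under [S] extends to its closure. *)
Lemma mean_envelope (u : X -> R^o) f : continuous u -> envelope f -> L (u \o f) = L u.
Proof.
move=> uc Ef; apply/eqP; rewrite -subr_eq0 -normr_eq0 eq_le normr_ge0 andbT.
rewrite leNgt; apply/negP => e0.
have [M [_ /(_ (M + 1))]] := compact_bounded (continuous_compact (continuous_subspaceT uc) Xc).
rewrite ltrDl ltr01 => /(_ isT) uM.
have nearf : \forall g \near (f : XX), envelope g ->
    `|L (u \o g) - L (u \o f)| < `|L (u \o f) - L u|.
  move: e0; apply: (@functional_separately_continuous R X XX setT envelope L 1 ler01 Llin _
    (M + 1) (fun x g => u (g x)) f Xc envelope_compact) => //.
  - by move=> g M' gc gM; rewrite mul1r; apply: Lle => // x _; exact: gM.
  - move=> g Eg x; apply: (@continuous_comp X X R^o g u); last exact: uc.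
    exact: (act_quasi Eg).
  - move=> x _ g; apply: (@continuous_comp XX X R^o (fun g => g x) u); last exact: uc.
    exact: ptws_eval_continuous.
  - by move=> x g _ _; apply: uM; exists (g x).
have [_ [s _ <-] /(_ (@envelope_act s))] := closure_near Ef nearf.
by rewrite Linv// distrC ltxx.
Qed.

(** For a functional [f], the function [u = |f e - f|] satisfies [u e = 0], so
    [L u = L (u e) = 0] and [u] vanishes on [F] since the mean is faithful. *)
Lemma idempotent_fixes e x : envelope e -> e \o e = e -> F x -> e x = x.
Proof.
move=> Ee ee Fx; apply: contrapT => /functional_separates[f [fl fle]]; apply.
have fjc := jc fl fle; have ec := act_quasi Ee.
have fjec : continuous (f \o j \o e).
  by move=> y; apply: (@continuous_comp X X R^o e (f \o j)); [exact: ec|exact: fjc].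
pose u y : R^o := `|(f (j (e y)) : R) - f (j y)|.
have uc : continuous u.
  by apply: continuous_abs => y; apply: cvgB; [exact: fjec|exact: fjc].
have Lu : L u = 0.
  rewrite -(mean_envelope uc Ee) -[RHS](functional0 Llin); congr L; apply/funext => y /=.
  by rewrite /u (_ : e (e y) = e y) ?subrr ?normr0// -[in RHS]ee.
have /eqP := minimal_mean_faithful uc (fun=> normr_ge0 _) Lu Fx.
by rewrite normr_eq0 subr_eq0 => /eqP.
Qed.

(** Ellis's theorem for the compact semigroup of the [g f], [g] in the envelope:
    it contains an idempotent, which is the identity on [F]. *)
Lemma envelope_left_inverse f : envelope f ->
  exists2 g, envelope g & forall x, F x -> g (f x) = x.
Proof.
move=> Ef.
have compr_c : continuous ((fun g => g \o f) : XX -> XX).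
  by apply: continuous_ptws => x; exact: ptws_eval_continuous.
have [|||_ [g Eg <-] gf] := @ellis_idempotent X space_hausdorff [set (g \o f : XX) | g in envelope].
- by apply: continuous_compact envelope_compact; exact: continuous_subspaceT.
- by exists (f \o f), f.
- move=> _ _ [g Eg <-] [h Eh <-]; exists (g \o (f \o h)) => //.
  by apply: envelope_comp => //; exact: envelope_comp.
exists g => // x Fx; apply: (idempotent_fixes (e := g \o f)) => //.
exact: envelope_comp.
Qed.

End mean.

Section finite_nets.
Hypothesis left_inv : forall f, envelope f ->
  exists2 g, envelope g & forall x, F x -> g (f x) = x.

Lemma minimal_isometry s x y : F x -> F y -> dist (act s x) (act s y) = dist x y.
Proof.
move=> Fx Fy; have [g Eg gs] := left_inv (@envelope_act s).
apply/eqP; rewrite eq_le act_nonexp/=.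
by have := envelope_nonexp (act s x) (act s y) Eg; rewrite !gs.
Qed.

(** Left inverses in a semigroup where every element has one are two-sided. *)
Lemma minimal_surjective s y : F y -> exists2 x, F x & act s x = y.
Proof.
move=> Fy; have [g Eg gs] := left_inv (@envelope_act s); have [h Eh hg] := left_inv Eg.
have Fgy : F (g y) := envelope_invariant Fcl Finv Eg Fy.
by exists (g y) => //; rewrite -[LHS]hg ?gs ?hg//; exact: Finv.
Qed.

(** Let [U] be a small open set given by [fragmented]. By minimality of [F] its
    preimages under the action cover [F]; each of them is as small as [U] because
    the action is isometric on [F]. *)
Lemma finite_net (e : R) : 0 < e -> exists ps : seq X,
  (forall p, p \in ps -> F p) /\ forall x, F x -> exists2 p, p \in ps & dist x p <= e.
Proof.
move=> e0; have Fc : compact F by apply: subclosed_compact Xc _.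
have [U [Uo FU] Udiam] := fragmented ND NZ jc Fc F0 e0.
have cover : F `<=` cover [set: S] (fun s => act s @^-1` U).
  move=> z Fz; apply: contrapT => Uz.
  have WF : F `&` \bigcap_(s in [set: S]) [set x | ~ U (act s x)] = F.
    apply: Fmin; first by move=> x [].
    - apply: closedI => //; apply: closed_bigI => s _.
      apply: (@preimage_closed _ _ (act s) (~` U)); last exact: open_closedC.
      by move=> x _; exact: act_continuous.
    - by exists z; split=> // s _ Usz; apply: Uz; exists s.
    - move=> s x [Fx Ux]; split; first exact: Finv.
      by move=> t _ /=; rewrite actM; exact: Ux.
  have [y [Fy Uy]] := FU; have [s _] := S0.
  have [x] := minimal_surjective s Fy; rewrite -WF => -[_ /(_ s Logic.I)/=].
  by move=> + sx; rewrite sx.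
pose miss (l : seq S) := F `&` [set x | forall s, s \in l -> ~ U (act s x)].
have [l lcover] : exists l : seq S, forall x, F x -> exists2 s, s \in l & U (act s x).
  apply: contrapT => nol.
  have [|l _|l m _ _|z zmiss] := @directed_bigcap X (seq S) setT miss F Fc.
  - by exists [::].
  - split=> [|x []//|].
      have -> : miss l = F `&` \bigcap_(s in [set` l]) [set x | ~ U (act s x)].
        by apply/seteqP; split.
      apply: closedI => //; apply: closed_bigI => s _.
      apply: (@preimage_closed _ _ (act s) (~` U)); last exact: open_closedC.
      by move=> x _; exact: act_continuous.
    apply: contrapT => ml; apply: nol; exists l => x Fx.
    apply: contrapT => nos; apply: ml; exists x; split=> // s sl Usx.
    by apply: nos; exists s.
  - exists (l ++ m) => // x [Fx xlm].
    by split; split=> // s sl; apply: xlm; rewrite mem_cat sl ?orbT.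
  have Fz : F z by have [] := zmiss [::] Logic.I.
  have [s _ Usz] := cover z Fz.
  have [_ /(_ s)] := zmiss [:: s] Logic.I; rewrite inE eqxx => /(_ isT).
  exact.
have [x0 Fx0] := F0.
pose piece s := F `&` act s @^-1` U.
exists [seq xget x0 (piece s) | s <- l]; split.
  move=> p /mapP[s _ ->]; have [[y sy]|sn] := pselect (piece s !=set0).
    by have [] := xgetPex x0 (ex_intro _ y sy).
  by rewrite xgetPN// => y sy; apply: sn; exists y.
move=> x Fx; have [s Ds sx] := lcover x Fx.
exists (xget x0 (piece s)); first by apply/mapP; exists s.
have [Fp Up] : piece s (xget x0 (piece s)) by apply: xgetPex; exists x.
rewrite -(minimal_isometry s Fx Fp); apply: Udiam => //; exact: Finv.
Qed.

End finite_nets.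
End minimal_set.

Hypothesis X0 : [set: X] !=set0.
Hypothesis orbit_mean : forall x0, exists L : (X -> R^o) -> R, [/\
  forall (a : R) (f g : X -> R^o), continuous f -> continuous g ->
    L (fun x => a * f x + g x) = a * L f + L g,
  forall (f : X -> R^o) (M : R), continuous f ->
    (forall t, `|f (act t x0)| <= M) -> L f <= M,
  L (fun=> 1) = 1 &
  forall s (f : X -> R^o), continuous f -> L (f \o act s) = L f].

Lemma minimal_left_inverse F f : F !=set0 -> closed F -> invariant F ->
  (forall C, C `<=` F -> closed C -> C !=set0 -> invariant C -> C = F) ->
  envelope f -> exists2 g, envelope g & forall x, F x -> g (f x) = x.
Proof.
move=> F0 Fcl Finv Fmin; have [x0 Fx0] := F0.
have [L [Llin Lle L1 Linv]] := orbit_mean x0.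
apply: (envelope_left_inverse Fcl Finv Fmin Llin _ L1 Linv) => h M hc hM.
by apply: Lle => // t; apply: hM; exact: Finv.
Qed.

(** DeMarr's argument: a minimal closed convex invariant set [K0] cannot contain a
    point [u] whose distances to [F] are all at most [r < D], where [D] is the
    diameter of [F]. *)
Theorem common_fixed_point : exists x, forall s, act s x = x.
Proof.
have [K0 [_ K0cl K0n [K0i K0m] K0min]] := @minimal_closed X
  [set C | invariant C /\ midconvex C] setT Xc closedT X0
  (conj (fun _ _ h => h) (fun _ _ _ _ _ _ => Logic.I))
  (fun G _ GP => conj (fun s x Gx C GC => (GP C GC).1 s x (Gx C GC))
    (fun x y z Gx Gy zE C GC => (GP C GC).2 x y z (Gx C GC) (Gy C GC) zE)).
have K0c : compact K0 by apply: subclosed_compact Xc _.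
have [F [FK0 Fcl F0 Finv Fmin]] := @minimal_closed X invariant K0 K0c K0cl K0n K0i
  (fun G _ GP s x Gx C GC => GP C GC s x (Gx C GC)).
have {}Fmin C : C `<=` F -> closed C -> C !=set0 -> invariant C -> C = F.
  by move=> CF Ccl C0 Ci; apply: Fmin.
have left_inv f := @minimal_left_inverse F f F0 Fcl Finv Fmin.
have net := finite_net F0 Fcl Finv Fmin left_inv.
have [x0 Fx0] := F0.
have [D0 D0P] : exists D0, forall x y, F x -> F y -> dist x y <= D0.
  have [ps [psF psP]] := net 1 ltr01.
  have [B BP] : exists B, forall p, p \in ps -> dist p x0 <= B.
    elim: ps {psF psP} => [|p ps [B BP]]; first by exists 0.
    exists (Num.max (dist p x0) B) => q; rewrite inE le_max.
    by case/predU1P=> [->|/BP ->]; rewrite ?lexx ?orbT.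
  have x0P x : F x -> dist x x0 <= 1 + B.
    move=> /psP[p pps xp]; apply: le_trans (seminorm_dist ND _ (j p) _) _.
    by rewrite lerD// BP.
  exists ((1 + B) + (1 + B)) => x y Fx Fy.
  apply: le_trans (seminorm_dist ND _ (j x0) _) _.
  by rewrite lerD ?x0P// seminormB// x0P.
pose dists := [set dist x.1 x.2 | x in F `*` F].
have dists_ub : has_ubound dists.
  by exists D0 => _ [[x y] [/= Fx Fy] <-]; exact: D0P.
pose D := sup dists.
have leD x y : F x -> F y -> dist x y <= D.
  by move=> Fx Fy; apply: ub_le_sup => //; exists (x, y).
have D_ge0 : 0 <= D by apply: le_trans (leD x0 x0 Fx0 Fx0); exact: seminorm_ge0.
have [D_gt0|] := ltP 0 D; last first.
  move=> D_le0; exists x0 => s; apply: jinj; apply/eqP; rewrite -subr_eq0; apply/eqP.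
  apply: N_eq0; apply/eqP; rewrite eq_le seminorm_ge0// andbT.
  by apply: le_trans D_le0; apply: leD => //; exact: Finv.
have [ps [psF psP]] := net (D / 2) (divr_gt0 D_gt0 (ltr0n _ 2)).
(* Each point [p] of the net is averaged with the point obtained so far: at
   a point within [D / 2] of [p], or where the previous bound was already less
   than [D], the distance to the midpoint is bounded away from [D]. *)
have [u [r [K0u rD uD ur]]] : exists u r, [/\ K0 u, r < D,
    forall x, F x -> dist x u <= D &
    forall x p, F x -> p \in ps -> dist x p <= D / 2 -> dist x u <= r].
  elim: ps psF {psP} => [|p ps IH] psF.
    exists x0, 0; split=> //; first exact: FK0.
    by move=> x Fx; exact: leD.
  have [q qps|u [r [K0u rD uD ur]]] := IH; first by apply: psF; rewrite inE qps orbT.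
  have Fp : F p by apply: psF; rewrite inE eqxx.
  have [v vE] := Xmid u p.
  have dv x : dist x v <= 2^-1 * dist x u + 2^-1 * dist x p.
    have -> : j x - j v = 2^-1 *: (j x - j u) + 2^-1 *: (j x - j p).
      by rewrite vE subr_midpoint.
    by apply: le_trans (ND _ _) _; rewrite !NZ ger0_norm// invr_ge0 ler0n.
  exists v, (Num.max (2^-1 * (r + D)) (3 / 4 * D)); split.
  - by apply: K0m vE => //; exact: FK0.
  - by rewrite gt_max; apply/andP; split; lra.
  - by move=> x Fx; have := dv x; have := uD x Fx; have := leD x p Fx Fp; lra.
  - move=> x q Fx; rewrite inE => qps xq; rewrite le_max; have := dv x.
    have := uD x Fx; have := leD x p Fx Fp.
    case/predU1P: qps => [qp|qps].
      by rewrite qp in xq => ? ? ?; apply/orP; right; lra.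
    by have := ur x q Fx qps xq => ? ? ? ?; apply/orP; left; lra.
(* Invariance of this set uses that [S] maps [F] onto itself. *)
have K1E : K0 `&` \bigcap_(x in F) [set y | dist x y <= r] = K0.
  apply: K0min; first by move=> y [].
  - by apply: closedI => //; apply: closed_bigI => x _; exact: dist_le_closed.
  - exists u; split=> // x Fx /=; have [p pps xp] := psP x Fx.
    exact: ur xp.
  - split.
    + move=> s y [K0y yr]; split; first exact: K0i.
      move=> x Fx /=; have [z Fz <-] := minimal_surjective Fcl Finv left_inv s Fx.
      by apply: le_trans (act_nonexp s z y) _; exact: yr.
    + move=> x y z [K0x xr] [K0y yr] zE; split; first exact: K0m zE.
      move=> t Ft /=; have := xr t Ft; have := yr t Ft => /= ? ?.
      have -> : j t - j z = 2^-1 *: (j t - j x) + 2^-1 *: (j t - j y).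
        by rewrite zE subr_midpoint.
      apply: le_trans (ND _ _) _; rewrite !NZ ger0_norm ?invr_ge0 ?ler0n//.
      lra.
have : D <= r.
  apply: ge_sup; first by exists (dist x0 x0), (x0, x0).
  move=> _ [[x y] [/= Fx Fy] <-].
  by have := FK0 y Fy; rewrite -K1E => -[_ /(_ x Fx)].
by rewrite leNgt rD.
Qed.

End common_fixed_point.

Local Open Scope complex_scope.

(** * Complex numbers and weak topologies *)

Section complex_modulus.
Context (R : realType).
Implicit Types z w : R[i].

Lemma normCE z : `|z| = (normc z)%:C.
Proof. by case: z. Qed.

Lemma norm_Re_le z : `|complex.Re z| <= normc z.
Proof. by rewrite -lecR -normCE normc_ge_Re. Qed.

Lemma norm_Im_le z : `|complex.Im z| <= normc z.
Proof.
case: z => a b /=; rewrite -sqrtr_sqr ler_wsqrtr// lerDr sqr_ge0//.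
Qed.

Lemma normc_real (x : R) : normc (x%:C : R[i]) = `|x|.
Proof. by rewrite /= expr0n/= addr0 sqrtr_sqr. Qed.

Lemma normc_i : normc ('i%C : R[i]) = 1.
Proof. by rewrite /= expr0n/= expr1n add0r sqrtr1. Qed.

Lemma normc_le_ReIm z : normc z <= `|complex.Re z| + `|complex.Im z|.
Proof.
have zE : z = (complex.Re z)%:C + 'i%C * (complex.Im z)%:C.
  by case: z => a b; simpc.
rewrite {1}zE; apply: le_trans (le_normcD _ _) _.
by rewrite normcM normc_i !normc_real mul1r.
Qed.

Lemma ReD z w : complex.Re (z + w) = complex.Re z + complex.Re w.
Proof. by case: z; case: w. Qed.

Lemma ReZ (a : R) z : complex.Re (a%:C * z) = a * complex.Re z.
Proof. by case: z => x y /=; rewrite mul0r subr0. Qed.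

Lemma ImD z w : complex.Im (z + w) = complex.Im z + complex.Im w.
Proof. by case: z; case: w. Qed.

Lemma ImZ (a : R) z : complex.Im (a%:C * z) = a * complex.Im z.
Proof. by case: z => x y /=; rewrite mul0r addr0. Qed.

Lemma complex_cvgP (T : Type) (F : set_system T) (f : T -> R[i]^o) (l : R[i]^o) : Filter F ->
  (f @ F --> l) <->
  (forall e : R, 0 < e -> \forall x \near F, normc (l - f x) < e).
Proof.
move=> FF; split=> [/cvgrPdist_lt fl e e0|fl].
  have e0' : 0 < e%:C by rewrite ltcR.
  by apply: filterS (fl _ e0') => x; rewrite normCE ltcR.
apply/cvgrPdist_lt => -[e1 e2]; rewrite ltcE/= => /andP[/eqP-> e10].
by apply: filterS (fl _ e10) => x; rewrite normCE -ltcR.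
Qed.

Lemma complex_cvg_ReIm (T : Type) (F : set_system T) (f : T -> R[i]^o) (l : R[i]^o) : Filter F ->
  (forall e : R, 0 < e -> \forall x \near F, `|complex.Re (f x) - complex.Re l| < e) ->
  (forall e : R, 0 < e -> \forall x \near F, `|complex.Im (f x) - complex.Im l| < e) ->
  f @ F --> l.
Proof.
move=> FF fRe fIm; apply/complex_cvgP => e e0.
have e20 : 0 < e / 2 by rewrite divr_gt0.
apply: filterS (filterI (fRe _ e20) (fIm _ e20)) => x [h1 h2].
apply: le_lt_trans (normc_le_ReIm _) _.
rewrite [ltRHS]splitr; apply: ltrD.
  by move: h1; rewrite distrC; case: (l) => ? ?; case: (f x).
by move: h2; rewrite distrC; case: (l) => ? ?; case: (f x).
Qed.

Lemma real_complex_continuous : continuous ((fun x => x%:C) : R^o -> R[i]^o).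
Proof.
move=> x; apply/complex_cvgP => e e0.
have /cvgrPdist_lt/(_ e e0) : (id : R^o -> R^o) @ x --> x by exact: cvg_id.
by apply: filterS => y; rewrite -rmorphB normc_real.
Qed.

Lemma near_normc (z : R[i]^o) (e : R) : 0 < e -> \forall w \near z, normc (z - w) < e.
Proof.
by move=> e0; apply: (complex_cvgP id z (nbhs_filter z)).1 => //; exact: cvg_id.
Qed.

Lemma Re_continuous : continuous ((@complex.Re R) : R[i]^o -> R^o).
Proof.
move=> z; apply/(@cvgrPdist_lt _ R^o _ (nbhs z) (nbhs_filter z)) => e e0.
near=> w; have : normc (z - w) < e by near: w; exact: near_normc.
apply: le_lt_trans; apply: le_trans (norm_Re_le _).
by case: (z) => ? ?; case: (w).
Unshelve. all: by end_near. Qed.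

Lemma Im_continuous : continuous ((@complex.Im R) : R[i]^o -> R^o).
Proof.
move=> z; apply/(@cvgrPdist_lt _ R^o _ (nbhs z) (nbhs_filter z)) => e e0.
near=> w; have : normc (z - w) < e by near: w; exact: near_normc.
apply: le_lt_trans; apply: le_trans (norm_Im_le _).
by case: (z) => ? ?; case: (w).
Unshelve. all: by end_near. Qed.

End complex_modulus.

Section weak_topology.
Context (K : numFieldType) (E : normedModType K).

Lemma initial_cvg (Z : choiceType) (T : topologicalType) (f : Z -> T)
  (F : set_system Z) (x : Z) : Filter F ->
  f @ F --> f x -> F --> (x : initial_topology f).
Proof.
move=> FF fF U [W' [/= [W oW <-] Wfx]] /filterS; apply; apply: fF.
exact: open_nbhs_nbhs.
Qed.

Lemma ptws_cvg (I : Type) (T : topologicalType) (F : set_system {ptws I -> T})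
  (f : {ptws I -> T}) : Filter F ->
  (forall i, (fun g : {ptws I -> T} => g i) @ F --> f i) -> F --> f.
Proof.
move=> FF Ff; apply/cvg_sup => i.
exact: (@initial_cvg _ _ (fun g : forall _ : I, T => g i)).
Qed.

Lemma weak_cvg (Z : Type) (F : set_system Z) (u : Z -> weak E) (x : weak E) : Filter F ->
  (forall phi : dual E, (sval phi \o u) @ F --> sval phi x) -> u @ F --> x.
Proof.
move=> FF ux; apply: initial_cvg; apply: ptws_cvg => phi; exact: ux.
Qed.

Lemma dual_continuous (phi : dual E) : continuous (sval phi : weak E -> K^o).
Proof.
move=> x; apply: (@continuous_comp (weak E) {ptws dual E -> K^o} K^o
  (@dual_eval K E) (fun g => g phi)).
  exact: initial_continuous.
exact: ptws_eval_continuous.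
Qed.

Lemma bounded_linear_dual (f : E -> K^o) (C : K) : linear f -> 0 <= C ->
  (forall x, `|f x| <= C * `|x|) -> exists phi : dual E, sval phi =1 f.
Proof.
move=> flin C0 fC; pose flin' := GRing.isLinear.Build _ _ _ _ f flin.
pose phi : {linear E -> K^o} := HB.pack f flin'.
have phic : continuous phi.
  apply: bounded_linear_continuous; apply/linear_boundedP.
  exists C; split; first exact: ger0_real.
  by move=> k /ltW Ck x; apply: le_trans (fC x) _; rewrite ler_wpM2r.
by exists (exist _ phi phic).
Qed.

Lemma dual_bounded (phi : dual E) : exists2 C : K, 0 < C &
  forall x, `|sval phi x| <= C * `|x|.
Proof.
have /linear_boundedP : bounded_near (sval phi) (nbhs 0).
  exact: continuous_linear_bounded (svalP phi 0).
move=> [M [Mr MP]]; exists (`|M| + 1); first by rewrite ltr_wpDl.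
move=> x; apply: MP; rewrite ltr_pwDr//.
exact: real_ler_norm.
Qed.

Lemma compact_set_type (T : topologicalType) (A : set T) :
  compact A -> compact [set: set_type A].
Proof.
move=> Ac F FF _.
have [|x [Ax xF]] := Ac ((val : set_type A -> T) @ F).
  by apply: (@filterS _ F _ setT) => [[y yA] _|]; [exact: set_mem yA|exact: filterT].
exists (exist _ x (mem_set Ax)); split=> // B C FB [W [[U oU <-] Ux]] UC.
have [_ [[y By <-] Uy]] : [set val y | y in B] `&` U !=set0.
  apply: xF; last exact: open_nbhs_nbhs.
  by apply: (@filterS _ F _ B) FB => y By; exists y.
by exists y; split=> //; exact: UC.
Qed.

End weak_topology.

(** * Bounded functions pulled back from a compact set *)

Section bounded_functions.
Context (R : realType) (T : topologicalType).

Lemma dual_bcfun_bounded (phi : dual (bcfun R T)) : exists2 C : R, 0 <= C &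
  forall f, normc (sval phi f) <= C * bcfun_norm f.
Proof.
have [[C1 C2]] := dual_bounded phi.
rewrite ltcE/= => /andP[/eqP-> C10] phiC; exists C1; first exact: ltW.
by move=> f; rewrite -lecR rmorphM/= -normCE; exact: phiC.
Qed.

Lemma bcfun_eval_dual (t : T) : exists phi : dual (bcfun R T), forall f, sval phi f = f t.
Proof.
have lin : linear ((fun f : bcfun R T => f t) : bcfun R T -> R[i]^o) by [].
have [|phi phiE] := @bounded_linear_dual _ _ _ 1 lin ler01.
  by move=> f /=; rewrite mul1r normCE lecR bcfun_norm_ub.
by exists phi => f; rewrite phiE.
Qed.

Lemma weak_bcfun_hausdorff : hausdorff_space (weak (bcfun R T)).
Proof.
apply: separated_hausdorff => f g fg.
have [t ft] : exists t, (f : bcfun R T) t <> (g : bcfun R T) t.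
  apply: contrapT => not_ex; apply: fg; apply/val_inj/funext => t.
  by apply: contrapT => ft; apply: not_ex; exists t.
have [phi phiE] := bcfun_eval_dual t.
exists R[i]^o, (sval phi); split; last by rewrite !phiE.
  exact: norm_hausdorff.
exact: dual_continuous.
Qed.

Lemma bcfun_eqP (f g : bcfun R T) : (forall t, f t = g t) -> f = g.
Proof. by move=> fg; apply/val_inj/funext. Qed.

End bounded_functions.

Section pullback.
Context (R : realType) (T Z : topologicalType) (Xs : set Z) (w : T -> Z) (t0 : T).
Hypothesis Xsc : compact Xs.
Hypothesis wXs : forall t, Xs (w t).
Hypothesis wc : continuous w.

Lemma compact_bound (u : Z -> R^o) : continuous u ->
  exists M : R, forall x, Xs x -> `|u x| <= M.
Proof.
move=> uc.
have [M [_ /(_ (M + 1))]] := compact_bounded (continuous_compact (continuous_subspaceT uc) Xsc).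
rewrite ltrDl ltr01 => /(_ isT) uM; exists (M + 1) => x Xx; apply: uM.
by exists x.
Qed.

Lemma pullback_subproof (u : Z -> R^o) : exists f : bcfun R T,
  continuous u -> forall t, f t = (u (w t))%:C.
Proof.
have [uc|] := pselect (continuous u); last by exists 0.
have fP : ((fun t => (u (w t))%:C) : T -> R[i]^o) \in @bounded_continuous R T.
  apply/asboolP; split.
    have [M uM] := compact_bound uc.
    by apply/bounded_fun_normcP; exists M => s; rewrite normc_real uM.
  move=> s; apply: (@continuous_comp T R^o R[i]^o (fun t => u (w t))).
    by apply: (@continuous_comp T Z R^o w u); [exact: wc|exact: uc].
  exact: real_complex_continuous.
by exists (BCFun fP).
Qed.

(** Total in [u], with an unspecified value when [u] is not continuous, so that
    a functional on bounded functions can be composed with it. *)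
Definition pullback (u : Z -> R^o) : bcfun R T := sval (cid (pullback_subproof u)).

Lemma pullbackE u t : continuous u -> pullback u t = (u (w t))%:C.
Proof. by move=> uc; rewrite (svalP (cid (pullback_subproof u)) uc). Qed.

Lemma pullback_norm u (M : R) : continuous u -> (forall t, `|u (w t)| <= M) ->
  bcfun_norm (pullback u) <= M.
Proof.
move=> uc uM; apply: bcfun_norm_le => [|t]; first exact: le_trans (uM t0).
by rewrite pullbackE// normc_real.
Qed.

Lemma pullback_lin (a : R) (u v : Z -> R^o) : continuous u -> continuous v ->
  pullback (fun x => a * u x + v x) = a%:C *: pullback u + pullback v.
Proof.
move=> uc vc; apply: bcfun_eqP => t; rewrite pullbackE.
  change ((a * u (w t) + v (w t))%:C =
    a%:C * (pullback u t : R[i]) + (pullback v t : R[i])).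
  by rewrite !pullbackE// rmorphD rmorphM.
by move=> x; apply: cvgD; [apply: cvgMl_tmp; exact: uc|exact: vc].
Qed.

(** Weak continuity is tested on a functional [phi], whose real and imaginary
    parts, composed with [pullback], are bounded functionals on the continuous
    functions on [Z]. *)
Lemma pullback_weak_continuous (T2 : topologicalType) (Y : set T2)
  (B : Z -> T2 -> R^o) (M : R) : compact Y ->
  (forall y, Y y -> continuous (B ^~ y)) ->
  (forall x, Xs x -> continuous (B x)) ->
  (forall x y, Xs x -> Y y -> `|B x y| <= M) ->
  {within Y, continuous ((fun y => pullback (B ^~ y)) : T2 -> weak (bcfun R T))}.
Proof.
move=> Yc Bc1 Bc2 BM; apply/subspace_continuousP => y0 Yy0; apply: weak_cvg => phi.
have [C C0 phiC] := dual_bcfun_bounded phi.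
have phiP P : (P = @complex.Re R \/ P = @complex.Im R) -> forall e : R, 0 < e ->
    \forall y \near y0, Y y ->
    `|P (sval phi (pullback (B ^~ y))) - P (sval phi (pullback (B ^~ y0)))| < e.
  move=> PE e e0.
  have PD z z' : P (z + z') = P z + P z' by case: PE => ->; [exact: ReD|exact: ImD].
  have PZ (a : R) z : P (a%:C * z) = a * P z by case: PE => ->; [exact: ReZ|exact: ImZ].
  have Ple z : P z <= normc z.
    apply: le_trans (ler_norm _) _.
    by case: PE => ->; [exact: norm_Re_le|exact: norm_Im_le].
  apply: (@functional_separately_continuous R Z T2 Xs Y
    (fun v => P (sval phi (pullback v))) C C0 _ _ M B y0 Xsc Yc) => //.
  - move=> a f g fc gc; rewrite pullback_lin// linearP PD; congr (_ + _).
    exact: PZ.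
  - move=> f M' fc fM'; apply: le_trans (Ple _) _; apply: le_trans (phiC _) _.
    by rewrite ler_wpM2l// pullback_norm// => t; exact: fM'.
apply: complex_cvg_ReIm => e e0.
  by have := phiP _ (or_introl erefl) e e0.
by have := phiP _ (or_intror erefl) e e0.
Qed.

End pullback.

(** * Orbit functions are weakly almost periodic *)

Section orbit_functions.
Context (R : realType) (S : semitopologicalSemigroupType).
Context (X : topologicalType) (act : S -> X -> X) (x0 : X).
Hypothesis Xc : compact [set: X].
Hypothesis actM : forall s t x, act s (act t x) = act (s * t)%g x.
Hypothesis act_quasi : forall g : {ptws X -> X}, envelope act g ->
  continuous (g : X -> X).
Hypothesis act_orbit : continuous (act ^~ x0).
Variable s0 : S.

Local Notation orbit_fun :=
  (pullback (w := act ^~ x0) Xc (fun=> Logic.I) act_orbit : (X -> R^o) -> bcfun R S).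

Lemma orbit_fun_translation s (u : X -> R^o) : continuous u ->
  left_translation s (orbit_fun u) = orbit_fun (u \o act s).
Proof.
move=> uc; have sc : continuous (act s) by apply: act_quasi; exact: envelope_act.
apply: bcfun_eqP => t.
change (orbit_fun u (s * t)%g = orbit_fun (u \o act s) t).
have usc : continuous (u \o act s).
  by move=> x; apply: (@continuous_comp X X R^o (act s) u); [exact: sc|exact: uc].
by rewrite (pullbackE _ _ _ t usc) (pullbackE _ _ _ (s * t)%g uc) /= actM.
Qed.

(** The translates of the function [t |-> u (t x0)] are the functions
    [t |-> u (g (t x0))] with [g] in the range of the action, and the image of
    the whole envelope under [g |-> (t |-> u (g (t x0)))] is weakly compact. *)
Lemma orbit_fun_WAP (u : X -> R^o) : continuous u -> @WAP R S (orbit_fun u).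
Proof.
move=> uc.
pose Psi := (fun g => orbit_fun (u \o g)) : {ptws X -> X} -> weak (bcfun R S).
have [M uM] := compact_bound Xc uc.
have Psic : compact (Psi @` envelope act).
  apply: continuous_compact; last exact: envelope_compact.
  apply: (@pullback_weak_continuous R S X setT (act ^~ x0) s0 Xc (fun=> Logic.I) act_orbit
    {ptws X -> X} (envelope act) (fun x g => u (g x)) M).
  - exact: envelope_compact.
  - move=> g Eg x; apply: (@continuous_comp X X R^o g u); last exact: uc.
    exact: (act_quasi Eg).
  - move=> x _ g; apply: (@continuous_comp {ptws X -> X} X R^o (fun g => g x) u); last exact: uc.
    exact: ptws_eval_continuous.
  - by move=> x g _ _; exact: uM.
exists (Psi @` envelope act); last first.
  by split=> //; apply: compact_closed => //; exact: weak_bcfun_hausdorff.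
move=> _ [s _ <-]; exists (act s); first exact: envelope_act.
by rewrite /Psi orbit_fun_translation.
Qed.

(** Invariance comes from [orbit_fun_translation], and the bound by the supremum
    along the orbit from the norm of [m], after rescaling. *)
Lemma orbit_mean (m : bcfun R S -> R[i]) : left_invariant_mean (@WAP R S) m ->
  exists L : (X -> R^o) -> R, [/\
  forall (a : R) (f g : X -> R^o), continuous f -> continuous g ->
    L (fun x => a * f x + g x) = a * L f + L g,
  forall (f : X -> R^o) (M : R), continuous f ->
    (forall t, `|f (act t x0)| <= M) -> L f <= M,
  L (fun=> 1) = 1 &
  forall s (f : X -> R^o), continuous f -> L (f \o act s) = L f].
Proof.
move=> [mlin mnorm m1 minv].
have Llin (a : R) (f g : X -> R^o) : continuous f -> continuous g ->
    complex.Re (m (orbit_fun (fun x => a * f x + g x))) =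
    a * complex.Re (m (orbit_fun f)) + complex.Re (m (orbit_fun g)).
  by move=> fc gc; rewrite pullback_lin// mlin; [rewrite ReD ReZ|exact: orbit_fun_WAP..].
exists (fun u => complex.Re (m (orbit_fun u))); split=> //.
- move=> f M fc fM; apply/ler_addgt0Pr => e e0.
  have Me : 0 < M + e.
    by rewrite ltr_wpDl//; exact: le_trans (fM s0).
  have zc : continuous ((fun=> 0) : X -> R^o) by move=> x; exact: cvg_cst.
  pose f' : X -> R^o := fun x => (M + e)^-1 * f x + 0.
  have f'c : continuous f'.
    by move=> x; apply: cvgD; [apply: cvgMl_tmp; exact: fc|exact: cvg_cst].
  have : complex.Re (m (orbit_fun f')) <= 1.
    apply: le_trans (ler_norm _) _; apply: le_trans (norm_Re_le _) _.
    rewrite -lee_fin -mnorm; apply: ereal_sup_ubound.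
    exists (orbit_fun f') => //; split; first exact: orbit_fun_WAP.
    change ((bcfun_norm (orbit_fun f'))%:C <= 1%:C); rewrite lecR.
    apply: pullback_norm => // t; rewrite /f' addr0 normrM gtr0_norm ?invr_gt0//.
    by rewrite ler_pdivrMl// mulr1 (le_trans (fM t))// lerDl ltW.
  have -> : complex.Re (m (orbit_fun f')) = (M + e)^-1 * complex.Re (m (orbit_fun f)).
    rewrite Llin// [X in _ + X](_ : _ = 0) ?addr0//.
    by rewrite (functional0 Llin).
  by rewrite ler_pdivrMl// mulr1.
- have -> : orbit_fun (fun=> 1) = bcfun_cst S 1.
    by apply: bcfun_eqP => t; rewrite pullbackE//= => x; exact: cvg_cst.
  by rewrite m1.
- by move=> s f fc; rewrite -orbit_fun_translation// minv//; exact: orbit_fun_WAP.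
Qed.

End orbit_functions.

(** * A left invariant mean gives fixed points *)

Section weak_subsets.
Context (K : numFieldType) (E : normedModType K) (A : set E).

Lemma weak_subset_val_continuous : continuous (val : weak_subset A -> weak E).
Proof. exact: initial_continuous. Qed.

Lemma weak_subset_compact : compact (A : set (weak E)) -> compact [set: weak_subset A].
Proof. exact: (@compact_set_type (weak E) A). Qed.

Lemma dual_weak_subset_continuous (phi : dual E) :
  continuous ((fun x => sval phi (val x)) : weak_subset A -> K^o).
Proof.
move=> x; apply: (@continuous_comp (weak_subset A) (weak E) K^o val (sval phi)).
  exact: weak_subset_val_continuous.
exact: dual_continuous.
Qed.

Lemma convex_midpoint : convex_set (A : set (convex_lmodType E)) ->
  forall x y : weak_subset A, exists z : weak_subset A,
    (val z : E) = 2^-1 *: ((val x : E) + val y).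
Proof.
move=> Aconv x y.
have h0 : 0 <= 2^-1 :> K by rewrite invr_ge0 ler0n.
have h1 : 2^-1 <= 1 :> K by rewrite invf_le1 ?ler1n// ltr0n.
have := Aconv (val x) (val y) (Itv01 h0 h1) (valP x) (valP y).
move=> zA; exists (exist (fun z : weak E => z \in (A : set (weak E))) _ zA) => /=.
rewrite scalerDr; congr (_ + _ *: _) => /=.
have half2 : 2^-1 + 2^-1 = 1 :> K.
  by rewrite -[LHS]mulr2n -[LHS]mulr_natr mulVf ?pnatr_eq0.
by apply/eqP; rewrite subr_eq half2.
Qed.

End weak_subsets.

(** An alias of [E] that carries its structure of real vector space. *)
Definition realify (R : realType) (E : lmodType R[i]) : Type := E.

Section realify.
Context (R : realType) (E : lmodType R[i]).

HB.instance Definition _ := GRing.Zmodule.copy (realify E) E.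

Definition realify_scale (a : R) (x : realify E) : realify E := (a%:C *: (x : E)).

Lemma realify_scaleA a b v : realify_scale a (realify_scale b v) = realify_scale (a * b) v.
Proof. by rewrite /realify_scale scalerA rmorphM. Qed.

Lemma realify_scale1 : left_id 1 realify_scale.
Proof. by move=> x; rewrite /realify_scale scale1r. Qed.

Lemma realify_scaleDr : right_distributive realify_scale +%R.
Proof. by move=> a x y; rewrite /realify_scale scalerDr. Qed.

Lemma realify_scaleDl v : {morph realify_scale^~ v : a b / a + b}.
Proof. by move=> a b; rewrite /realify_scale rmorphD scalerDl. Qed.

HB.instance Definition _ := GRing.Zmodule_isLmodule.Build R (realify E)
  realify_scaleA realify_scale1 realify_scaleDr realify_scaleDl.

End realify.

Section mean_implies_fixed_point.
Context (R : realType) (S : semitopologicalSemigroupType) (m : bcfun R S -> R[i]).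
Hypothesis S0 : [set: S] !=set0.
Hypothesis mLIM : left_invariant_mean (@WAP R S) m.

Theorem mean_fixed_point_real : fixed_point_property S R.
Proof.
move=> E A [a Aa] Ac Aconv act actM [_ act_cont] quasi nonexp.
have Xc := weak_subset_compact Ac.
apply: (@common_fixed_point R E (fun x => `|x|) _ _ _ (weak_subset A) val) => //.
- exact: ler_normD.
- by move=> b x; rewrite normrZ.
- by move=> x /normr0_eq0.
- move=> f fl fle.
  have [|phi phiE] := @bounded_linear_dual R E f 1 fl ler01.
    move=> x; rewrite mul1r ler_norml fle andbT.
    by have := fle (- x); rewrite linear_funN// normrN lerNl.
  have -> : f \o val = (fun x : weak_subset A => sval phi (val x)).
    by apply/funext => x /=; rewrite phiE.
  exact: dual_weak_subset_continuous.
- exact: convex_midpoint.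
- by exists (exist (fun z : weak E => z \in (A : set (weak E))) a (mem_set Aa)).
- move=> x0; have [s0 _] := S0; apply: (orbit_mean Xc actM quasi _ s0 mLIM).
  exact: act_cont.
Qed.

Theorem mean_fixed_point_complex : fixed_point_property S R[i].
Proof.
move=> E A [a Aa] Ac Aconv act actM [_ act_cont] quasi nonexp.
have Xc := weak_subset_compact Ac.
have normE (x : E) : `|x| = (complex.Re `|x|)%:C by rewrite RRe_real// normr_real.
apply: (@common_fixed_point R (realify E) (fun x : E => complex.Re `|x|) _ _ _
  (weak_subset A) val) => //.
- by move=> x y; rewrite -lecR rmorphD/= -!normE ler_normD.
- move=> b x; apply: complexI; rewrite -normE rmorphM/= -normE.
  rewrite -normc_real -normCE -normrZ; exact: erefl.
- by move=> x x0; apply: normr0_eq0; rewrite normE x0.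
- move=> f fl fle.
  have fB : forall x y : realify E, f (x - y) = (f x : R) - f y := linear_funB fl.
  have fD (x y : E) : f (x + y) = (f x : R) + f y.
    by have := fB x (- y : E); rewrite (linear_funN fl) !opprK.
  have fZ (b : R) (x : E) : f (b%:C *: x) = b * f x.
    by have := fl b x 0; rewrite (linear_fun0 fl) !addr0.
  (* The complex functional with real part [f]. *)
  pose g (x : E) : R[i]^o := (f x) -i* (f ('i%C *: x)).
  have cE (c : R[i]) (x : E) :
      c *: x = (complex.Re c)%:C *: x + (complex.Im c)%:C *: ('i%C *: x).
    rewrite scalerA -scalerDl; congr (_ *: _).
    by case: c => c1 c2; simpc.
  have iiE (x : E) : 'i%C *: ('i%C *: x) = - x.
    by rewrite scalerA -scaleN1r; congr (_ *: _); simpc.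
  have fc (c : R[i]) (x : E) :
      f (c *: x) = complex.Re c * f x + complex.Im c * f ('i%C *: x).
    by rewrite cE fD !fZ.
  have fi (c : R[i]) (x : E) :
      f ('i%C *: (c *: x)) = complex.Re c * f ('i%C *: x) - complex.Im c * f x.
    rewrite scalerA mulrC -scalerA fc iiE.
    have -> : f (- x : E) = - (f x : R) := linear_funN fl x.
    by rewrite mulrN.
  have glin : linear g.
    move=> c x y; rewrite /g scalerDr !fD fc fi.
    case: c => c1 c2; apply/eqP; rewrite eq_complex /=; apply/andP.
    by split; apply/eqP; ring.
  have fabs (x : E) : `|f x| <= complex.Re `|x|.
    rewrite ler_norml fle andbT; have := fle (- x : E).
    by rewrite (linear_funN fl) normrN lerNl.
  have normi (x : E) : complex.Re `|'i%C *: x| = complex.Re `|x|.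
    have -> : `|'i%C *: x| = `|x|; last by [].
    by rewrite normrZ normCE normc_i mul1r.
  have [||phi phiE] := @bounded_linear_dual R[i] E g (2%:R : R)%:C glin.
  - by rewrite -[0]/(0%:C) lecR.
  - move=> x; rewrite normCE [`|x|]normE -rmorphM lecR.
    apply: le_trans (normc_le_ReIm _) _; rewrite /= normrN.
    by have := fabs x; have := fabs ('i%C *: x); rewrite normi; lra.
  have -> : f \o val = @complex.Re R \o (fun x : weak_subset A => sval phi (val x)).
    by apply/funext => x /=; rewrite phiE.
  move=> x; apply: (@continuous_comp (weak_subset A) R[i]^o R^o).
    exact: dual_weak_subset_continuous.
  exact: Re_continuous.
- move=> x y; have [z zE] := convex_midpoint Aconv x y; exists z; rewrite zE.
  change (2^-1 *: ((val x : E) + val y) = (2^-1 : R)%:C *: ((val x : E) + val y)).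
  by rewrite fmorphV rmorph_nat.
- by move=> s x y; have := nonexp s x y; rewrite normE [X in _ <= X]normE lecR.
- by exists (exist (fun z : weak E => z \in (A : set (weak E))) a (mem_set Aa)).
- move=> x0; have [s0 _] := S0; apply: (orbit_mean Xc actM quasi _ s0 mLIM).
  exact: act_cont.
Qed.

End mean_implies_fixed_point.

(** * Completeness of the space of bounded continuous functions *)

Section bcfun_complete.
Context (R : realType) (T : topologicalType).
Local Notation CT := (bcfun R T).

Lemma bcfun_normE (f : CT) : `|f| = (bcfun_norm f)%:C.
Proof. by []. Qed.

Lemma bcfun_norm_dist_le (f g : CT) t : normc (f t - g t) <= bcfun_norm (f - g).
Proof. exact: (bcfun_norm_ub (f - g) t). Qed.

Lemma normc_sym (z w : R[i]) : normc (z - w) = normc (w - z).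
Proof. by apply: complexI; rewrite -!normCE distrC. Qed.

Lemma normc_triangle (y x z : R[i]) : normc (x - z) <= normc (x - y) + normc (y - z).
Proof. by rewrite -{1}(subrK y x) -addrA le_normcD. Qed.

Lemma bcfun_cauchy_cvg (F : set_system CT) : ProperFilter F -> cauchy F -> cvg F.
Proof.
move=> FF /cauchyP Fcauchy.
have Fnear (e : R) : 0 < e -> exists f0 : CT, \forall f \near F, bcfun_norm (f0 - f) < e.
  move=> e0; have e0' : 0 < e%:C :> R[i] by rewrite ltcR.
  have [f0 Ff0] := Fcauchy _ e0'; exists f0; apply: filterS Ff0 => f.
  by rewrite -ball_normE /= bcfun_normE ltcR.
have part (P : R[i] -> R) : (forall z w, P (z - w) = P z - P w) ->
    (forall z, `|P z| <= normc z) ->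
    forall t, exists r : R, (fun f : CT => P (f t)) @ F --> (r : R^o).
  move=> PB Ple t; apply/cvg_ex; apply: (@R_complete R); apply: cauchy_exP => e e0.
  have [f0 Ff0] := Fnear e e0; exists (P (f0 t)).
  apply: filterS Ff0 => f ff0; rewrite -ball_normE /= -PB.
  by apply: le_lt_trans ff0; apply: le_trans (Ple _) _; exact: bcfun_norm_dist_le.
have ReB (z w : R[i]) : complex.Re (z - w) = complex.Re z - complex.Re w by case: z; case: w.
have ImB (z w : R[i]) : complex.Im (z - w) = complex.Im z - complex.Im w by case: z; case: w.
have zP t : exists z : R[i]^o, (fun f : CT => f t) @ F --> z.
  have [r rP] := part _ ReB (@norm_Re_le R) t; have [i iP] := part _ ImB (@norm_Im_le R) t.
  exists (r +i* i); apply: complex_cvg_ReIm => e e0.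
    move/cvgrPdist_lt : rP => /(_ e e0); apply: filterS => f.
    by rewrite distrC.
  move/cvgrPdist_lt : iP => /(_ e e0); apply: filterS => f.
  by rewrite distrC.
pose z t : R[i]^o := sval (cid (zP t)).
have zcvg t : (fun f : CT => f t) @ F --> z t := svalP (cid (zP t)).
have zdist (f0 : CT) (e : R) : (\forall f \near F, bcfun_norm (f0 - f) < e) ->
    forall t, normc (z t - f0 t) <= e.
  move=> Ff0 t; apply/ler_addgt0Pr => d d0.
  have [f [h1 h2]] := @filter_ex _ F _ _ (filterI Ff0 ((complex_cvgP _ _ _).1 (zcvg t) d d0)).
  apply: le_trans (normc_triangle (f t) _ _) _; rewrite addrC lerD//; last exact: ltW.
  by rewrite normc_sym; apply: le_trans (ltW h1); exact: bcfun_norm_dist_le.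
have zP' : z \in @bounded_continuous R T.
  apply/asboolP; split.
    have [f0 /zdist f0P] := Fnear 1 ltr01.
    apply/bounded_fun_normcP; exists (1 + bcfun_norm f0) => t.
    rewrite -[z t](subrK (f0 t)); apply: le_trans (le_normcD _ _) _.
    by rewrite lerD// bcfun_norm_ub.
  move=> t0; apply/complex_cvgP => e e0.
  have e30 : 0 < e / 3 by rewrite divr_gt0.
  have [f0 /zdist f0P] := Fnear _ e30.
  have /asboolP[_ f0c] := bcfunP f0.
  have := (complex_cvgP _ _ (nbhs_filter t0)).1 (f0c t0) _ e30.
  apply: filterS => t ft.
  have := normc_triangle (f0 t0) (z t0) (z t).
  have := normc_triangle (f0 t) (f0 t0) (z t).
  move: ft (f0P t0) (f0P t) => /=; rewrite (normc_sym (z t) (f0 t)).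
  lra.
apply/cvg_ex; exists (BCFun zP'); apply/cvgrPdist_lt => -[e1 e2].
rewrite ltcE/= => /andP[/eqP-> e10].
have e20 : 0 < e1 / 2 / 2 by rewrite !divr_gt0.
have [f0 Ff0] := Fnear _ e20; have f0P := zdist _ _ Ff0.
apply: filterS Ff0 => f ff0; change ((bcfun_norm (BCFun zP' - f))%:C < e1%:C).
rewrite ltcR; apply: (@le_lt_trans _ _ (e1 / 2)); last first.
  by rewrite ltr_pdivrMr// ltr_pMr// ltr1n.
apply: bcfun_norm_le => [|t]; first by rewrite ltW// divr_gt0.
change (normc (z t - f t) <= e1 / 2).
apply: le_trans (normc_triangle (f0 t) _ _) _.
have := bcfun_norm_dist_le f0 f t; have := f0P t; lra.
Qed.

HB.instance Definition _ := isPointed.Build CT 0.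
HB.instance Definition _ := Uniform_isComplete.Build CT bcfun_cauchy_cvg.

End bcfun_complete.

(** * The compact set of means *)

(** On a compact set, the topology is determined by any family of continuous
    maps that separates the points. *)
Lemma compact_coordinates_cvg (I Y : Type) (ZT : topologicalType) (U : I -> topologicalType)
  (F : set_system Y) (q : Y -> ZT) (W : set ZT) (c : forall i, ZT -> U i) (z0 : ZT) :
  Filter F -> compact W -> (\forall y \near F, W (q y)) ->
  (forall i, hausdorff_space (U i)) -> (forall i, continuous (c i)) ->
  (forall z, W z -> (forall i, c i z = c i z0) -> z = z0) ->
  (forall i, (c i \o q) @ F --> c i z0) -> q @ F --> z0.
Proof.
move=> FF Wc FW hU cc sep cvg N Nz0; apply: contrapT => FN.
pose D := ~` (q @^-1` N).
have wF : ProperFilter (within D F).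
  apply: Build_ProperFilter_ex => B FB; apply: contrapT => B0; apply: FN.
  change (F (q @^-1` N)); change (F [set y | D y -> B y]) in FB.
  apply: filterS FB => y DB; apply: contrapT => nN.
  by apply: B0; exists y; exact: DB.
have [|z [Wz zcl]] := Wc (q @ within D F).
  change (F [set y | D y -> W (q y)]).
  by apply: filterS FW => y Wy _.
have zz0 : z = z0.
  apply: sep => // i; apply: (hU i) => A B zA zB.
  have FB : (q @ within D F) (c i @^-1` B).
    change (F [set y | D y -> B (c i (q y))]).
    by apply: (@filterS _ F _ (fun y => B (c i (q y))) _ _ (cvg i B zB)) => y By _.
  have [z' [Bz' Az']] := zcl _ _ FB (cc i z _ zA).
  by exists (c i z').
rewrite zz0 in zcl.
have [|z' []//] := zcl (~` N) N _ Nz0.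
change (F [set y | D y -> ~ N (q y)]).
by apply: (@filterS _ F _ setT) => [y _|]; [|exact: filterT].
Qed.

Section means.
Context (R : realType) (S : semitopologicalSemigroupType).
Local Notation CS := (bcfun R S).
Local Notation functionals := {ptws CS -> R[i]^o}.

Definition means : set functionals := [set m |
  [/\ forall (a : R[i]) f g, m (a *: f + g) = a * m f + m g,
      forall f, normc (m f) <= bcfun_norm f & m (bcfun_cst S 1) = 1]].

(** Rectangles rather than discs, as images of products of segments. *)
Lemma rectangle_compact (r : R) :
  compact [set z : R[i]^o | `|complex.Re z| <= r /\ `|complex.Im z| <= r].
Proof.
pose f (x : R^o * R^o) : R[i]^o := x.1%:C + 'i%C * x.2%:C.
have fc : continuous f.
  move=> x; apply: cvgD.
    apply: (@continuous_comp (R^o * R^o)%type R^o R[i]^o fst); first exact: cvg_fst.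
    exact: real_complex_continuous.
  apply: cvgMl_tmp; apply: (@continuous_comp (R^o * R^o)%type R^o R[i]^o snd); first exact: cvg_snd.
  exact: real_complex_continuous.
have -> : [set z : R[i]^o | `|complex.Re z| <= r /\ `|complex.Im z| <= r] =
    f @` ([set` `[- r, r]] `*` [set` `[- r, r]]).
  apply/seteqP; split=> [[a b] [/= ar br]|_ [[a b] [/= ar br] <-]].
    exists (a, b); last by rewrite /f; simpc.
    by split; rewrite /= in_itv/= -ler_norml.
  by move: ar br; rewrite /f !in_itv/= -!ler_norml; simpc.
apply: continuous_compact; first exact: continuous_subspaceT.
by apply: compact_setX; exact: segment_compact.
Qed.

Lemma closed_preimage_normc_le (T : topologicalType) (f : T -> R[i]^o) (r : R) :
  continuous f -> closed [set t | normc (f t) <= r].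
Proof.
move=> fc; apply: (closed_preimage_le (f := fun t => normc (f t) : R^o)).
move=> t; apply/cvgrPdist_lt => e e0.
apply: filterS ((complex_cvgP _ _ (nbhs_filter t)).1 (fc t) e e0) => t'.
have tri a b : normc (a : R[i]) <= normc (a - b) + normc b.
  by rewrite -{1}(subrK b a) le_normcD.
apply: le_lt_trans; have := tri (f t) (f t'); have := tri (f t') (f t).
by rewrite (normc_sym (f t')) ler_norml => ? ?; apply/andP; split; lra.
Qed.

Lemma linear_defect_continuous (T : topologicalType) (a : R[i]) (f g h : T -> R[i]^o) :
  continuous f -> continuous g -> continuous h ->
  continuous (fun t => f t - (a *: g t + h t) : R[i]^o).
Proof.
move=> fc gc hc t; apply: cvgB; first exact: fc.
by apply: cvgD; [apply: cvgZl_tmp; exact: gc|exact: hc].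
Qed.

Lemma means_compact : compact means.
Proof.
pose A (f : CS) := [set z : R[i]^o | `|complex.Re z| <= bcfun_norm f /\
  `|complex.Im z| <= bcfun_norm f].
have Ac : compact [set m : functionals | forall f, A f (m f)].
  by apply: tychonoff => f; exact: rectangle_compact.
have ev f := @ptws_eval_continuous CS R[i]^o f.
apply: subclosed_compact Ac _; last first.
  move=> m [_ mb _] f; split; apply: le_trans (mb f).
    exact: norm_Re_le.
  exact: norm_Im_le.
have -> : means = (\bigcap_(afg in [set: R[i] * CS * CS])
     [set m : functionals | m (afg.1.1 *: afg.1.2 + afg.2) -
        (afg.1.1 *: (m afg.1.2 : R[i]^o) + m afg.2) = 0]) `&`
   (\bigcap_(f in [set: CS]) [set m : functionals | normc (m f) <= bcfun_norm f]) `&`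
   [set m : functionals | m (bcfun_cst S 1) = 1].
  apply/seteqP; split=> [m [ml mb m1]|m [[ml mb] m1]].
    split=> //; split=> [[[a f] g] _ /=|f _]; first by rewrite ml subrr.
    exact: mb.
  split=> // [a f g|f]; last exact: mb.
  by have /= /eqP := ml (a, f, g) Logic.I; rewrite subr_eq0 => /eqP.
have h1 (z : R[i]^o) : closed [set z].
  exact: accessible_closed_set1 (hausdorff_accessible (@norm_hausdorff _ _)) z.
apply: closedI; first apply: closedI.
- apply: closed_bigI => -[[a f] g] _ /=.
  have lc : continuous
      ((fun m => m (a *: f + g) - (a *: (m f : R[i]^o) + m g)) : functionals -> R[i]^o).
    apply: (@linear_defect_continuous functionals a (fun m => m (a *: f + g))
      (fun m => m f) (fun m => m g)); exact: ptws_eval_continuous.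
  by apply: (preimage_closed (fun m _ => lc m) (h1 0)).
- by apply: closed_bigI => f _; apply: closed_preimage_normc_le; exact: ev.
- apply: (@preimage_closed _ _ (fun m : functionals => m (bcfun_cst S 1)) [set 1]) => //.
Qed.

End means.

Lemma discrete_continuous (D : choiceType) (U : topologicalType)
  (f : discrete_topology D -> U) : continuous f.
Proof.
move=> x N Nfx; apply: (filterS _ (discrete_set1 x)) => y /= ->.
exact: (nbhs_singleton Nfx).
Qed.

(** * Left translations *)

Section left_translations.
Context (R : realType) (S : semitopologicalSemigroupType).
Local Notation CS := (bcfun R S).
Local Notation functionals := {ptws CS -> R[i]^o}.
Implicit Types (f g : CS) (m : functionals).

Lemma left_translation_lin s (a : R[i]) f g :
  left_translation s (a *: f + g) = a *: left_translation s f + left_translation s g.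
Proof. exact: bcfun_eqP. Qed.

Lemma left_translation_cst s (a : R[i]) :
  left_translation s (bcfun_cst S a) = bcfun_cst S a.
Proof. exact: bcfun_eqP. Qed.

Lemma left_translationM s t f :
  left_translation s (left_translation t f) = left_translation (t * s)%g f.
Proof. by apply: bcfun_eqP => u /=; rewrite mulgA. Qed.

Lemma left_translation_norm s f : bcfun_norm (left_translation s f) <= bcfun_norm f.
Proof.
by apply: bcfun_norm_le => [|t]; [exact: bcfun_norm_ge0|exact: (bcfun_norm_ub f (s * t)%g)].
Qed.

Definition translate_functional (s : S) m : functionals :=
  fun f => m (left_translation s f).

Lemma means_translate s m : means m -> means (translate_functional s m).
Proof.
move=> [ml mb m1]; split=> [a f g|f|]; rewrite /translate_functional.
- by rewrite left_translation_lin ml.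
- exact: le_trans (mb _) (left_translation_norm s f).
- by rewrite left_translation_cst.
Qed.

Lemma means_eval s : @means R S (fun f => f s).
Proof. by split=> // f; exact: bcfun_norm_ub. Qed.

Lemma means_dual m : means m -> exists phi : dual CS, forall f, sval phi f = m f.
Proof.
move=> [ml mb _].
have [|phi phiE] := @bounded_linear_dual R[i] CS m 1 ml ler01.
  by move=> f; rewrite mul1r normCE bcfun_normE lecR.
by exists phi.
Qed.

Lemma means_convex (a : R[i]) m m' : 0 <= a -> a <= 1 -> means m -> means m' ->
  @means R S (fun f => a * m f + (1 - a) * m' f).
Proof.
move=> a0 a1 [ml mb m1] [ml' mb' m1'].
have b0 : 0 <= 1 - a by rewrite subr_ge0.
split=> [b f g|f|].
- by rewrite ml ml'; ring.
- rewrite -lecR -normCE; apply: le_trans (ler_normD _ _) _.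
  rewrite !normrM (ger0_norm a0) (ger0_norm b0) !normCE.
  have -> : (bcfun_norm f)%:C = a * (bcfun_norm f)%:C + (1 - a) * (bcfun_norm f)%:C by ring.
  by rewrite lerD// ler_wpM2l// lecR.
- by rewrite m1 m1'; ring.
Qed.

Lemma bcfun_eval_weak_continuous (T : topologicalType) (t : T) :
  continuous ((fun f : bcfun R T => f t) : weak (bcfun R T) -> R[i]^o).
Proof.
have [phi phiE] := bcfun_eval_dual R t.
have -> : (fun f : bcfun R T => f t) = sval phi by apply/funext => f; rewrite phiE.
exact: dual_continuous.
Qed.

(** The map is continuous for the topology of pointwise convergence, which
    agrees with the weak topology on the weakly compact closure of the orbit. *)
Lemma WAP_translation_continuous f : @WAP R S f ->
  continuous ((fun s => left_translation s f) : S -> weak CS).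
Proof.
move=> [W fW [Wc _]] s.
apply: (@compact_coordinates_cvg S _ (weak CS) (fun=> R[i]^o) (nbhs s)
  (fun s => left_translation s f) W (fun t (g : CS) => g t)) => //.
- by apply: (@filterS _ (nbhs s) _ setT) => [t _|]; [apply: fW; exists t|exact: filterT].
- by move=> t; exact: bcfun_eval_weak_continuous.
- by move=> g _ gE; exact: bcfun_eqP.
- move=> t; have /asboolP[_ fc] := bcfunP f.
  by apply: (@continuous_comp S S R[i]^o (fun s => s * t)%g f); [exact: mulg_continuousr|exact: fc].
Qed.

Lemma weak_ball_closed (T : topologicalType) (r : R) :
  closed [set f : weak (bcfun R T) | forall t, normc ((f : bcfun R T) t) <= r].
Proof.
have -> : [set f : weak (bcfun R T) | forall t, normc ((f : bcfun R T) t) <= r] =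
    \bigcap_(t in [set: T]) [set f : weak (bcfun R T) | normc ((f : bcfun R T) t) <= r].
  by apply/seteqP; split=> f fr t; [move=> _; exact: fr|exact: (fr t Logic.I)].
apply: closed_bigI => t _; apply: closed_preimage_normc_le.
exact: bcfun_eval_weak_continuous.
Qed.

(** The bound [r] on the weak closures of the orbits comes from the norms of the
    functions in [fs], since the evaluations are weakly continuous. *)
Lemma WAP_container (fs : seq CS) : (forall f, f \in fs -> @WAP R S f) ->
  exists (W : set (weak CS)) (r : R), [/\ compact W, W (0 : CS),
    forall f, f \in fs -> W f /\ forall s, W (left_translation s f) &
    forall f, W f -> forall s, normc ((f : CS) s) <= r].
Proof.
move=> fsW.
have [r [r0 fr]] : exists r : R, 0 <= r /\ forall f, f \in fs -> bcfun_norm f <= r.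
  elim: fs {fsW} => [|f fs [r [r0 rP]]]; first by exists 0.
  exists (Num.max (bcfun_norm f) r); split; first by rewrite le_max r0 orbT.
  by move=> g; rewrite inE le_max => /predU1P[->|/rP ->]; rewrite ?lexx ?orbT.
have [W [Wc W0 Wfs]] : exists W : set (weak CS), [/\ compact W, W (0 : CS) &
    forall f, f \in fs -> W f /\ forall s, W (left_translation s f)].
  elim: fs fsW {fr} => [|f fs IH] fsW.
    by exists [set (0 : CS)]; split=> //; exact: compact_set1.
  have [|W [Wc W0 Wfs]] := IH; first by move=> g gfs; apply: fsW; rewrite inE gfs orbT.
  have [U fU [Uc _]] := fsW f (mem_head _ _).
  exists ((W `|` U) `|` [set f]); split.
  - by apply: compactU; [exact: compactU|exact: compact_set1].
  - by left; left.
  - move=> g; rewrite inE => /predU1P[->|/Wfs[Wg Wlg]].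
      by split=> [|s]; [right|left; right; apply: fU; exists s].
    by split=> [|s]; left; left.
exists (W `&` [set f : weak CS | forall t, normc ((f : CS) t) <= r]), r; split.
- by apply: compact_closedI => //; exact: weak_ball_closed.
- by split=> // t; rewrite normc0.
- move=> f ffs; have [Wf Wlf] := Wfs f ffs.
  split=> [|s]; split=> // t; apply: le_trans (bcfun_norm_ub _ _) _; first exact: fr.
  by apply: le_trans (left_translation_norm _ _) _; exact: fr.
- by move=> f [].
Qed.

End left_translations.

(** * Invariant means on finite families *)

Lemma weak_cvg_lin (K : numFieldType) (E : normedModType K) (T : Type) (F : set_system T)
  (u v : T -> weak E) (x y : weak E) (c : K) : Filter F -> u @ F --> x -> v @ F --> y ->
  (fun t => c *: (u t : E) + v t : weak E) @ F --> (c *: (x : E) + y : weak E).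
Proof.
move=> FF ux vy; apply: weak_cvg => phi.
have -> : sval phi \o (fun t => c *: (u t : E) + v t : weak E) =
    (fun t => c *: (sval phi (u t) : K^o) + sval phi (v t)).
  by apply/funext => t /=; rewrite linearP.
rewrite linearP; apply: cvgD; first apply: cvgZl_tmp.
  exact: (cvg_comp _ _ ux (@dual_continuous _ _ phi x)).
exact: (cvg_comp _ _ vy (@dual_continuous _ _ phi y)).
Qed.

Section finite_families.
Context (R : realType) (S : semitopologicalSemigroupType) (s0 : S).
Local Notation CS := (bcfun R S).
Local Notation functionals := {ptws CS -> R[i]^o}.
Local Notation means := (@means R S).
Variable fs : seq CS.
Hypothesis fsW : forall f, f \in fs -> @WAP R S f.

(** An index [(f, Some u)] stands for [l_u f] and [(f, None)] for [f] itself, as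
    if an identity were adjoined to [S]: without it, a fixed point would only
    yield [m (l_us f) = m (l_u f)]. The discrete topology makes the bounded
    functions of such indices elements of [bcfun]. *)
Definition translate_index := discrete_topology (CS * option S)%type.

Definition index_shift (s : S) (t : translate_index) : translate_index :=
  (t.1, Some (if t.2 is Some u then (u * s)%g else s)).

(** The value 0 outside [fs] avoids an index type that depends on [fs]. *)
Definition translates (t : translate_index) : weak CS :=
  if t.1 \in fs then if t.2 is Some u then left_translation u t.1 else t.1 else (0 : CS).

Lemma translates_shift s t :
  translates (index_shift s t) = left_translation s (translates t).
Proof.
rewrite /translates; case: ifP => _ /=; last exact: bcfun_eqP.
by case: t.2 => [u|//]; rewrite left_translationM.
Qed.

Local Notation E := (bcfun R translate_index).

(** The map is [m |-> (t |-> m (translates t))]. Its weak continuity follows from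
    [pullback_weak_continuous] applied to the real and imaginary parts of the
    separately continuous pairing [(f, m) |-> m f]. *)
Lemma weak_evaluation_map : exists Psi : functionals -> weak E,
  {within means, continuous Psi} /\
  forall m, means m -> forall t, (Psi m : E) t = m (translates t).
Proof.
have [W [r [Wc W0 Wfs Wr]]] := WAP_container fsW.
have fW t : W (translates t).
  rewrite /translates; case: ifP => // /Wfs[Wf Wl]; case: t.2 => [u|]; [exact: Wl|exact: Wf].
have fc : continuous translates := @discrete_continuous _ _ translates.
pose i0 : translate_index := (0, None).
pose re : (weak CS -> R^o) -> E := pullback Wc fW fc.
have dualc m : means m -> continuous (m : weak CS -> R[i]^o).
  move=> /means_dual[phi phiE]; have -> : m = sval phi by apply/funext => f; rewrite phiE.
  exact: dual_continuous.
have part (P : R[i]^o -> R^o) : continuous P ->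
    (forall z, `|P z| <= normc z) ->
    {within means, continuous ((fun m => re (fun f => P (m f))) : functionals -> weak E)}.
  move=> Pc Ple.
  apply: (@pullback_weak_continuous R translate_index (weak CS) W translates i0 Wc fW fc
    functionals means (fun f m => P (m f)) r).
  - exact: means_compact.
  - move=> m mm f; apply: (@continuous_comp (weak CS) R[i]^o R^o m P); last exact: Pc.
    exact: dualc.
  - move=> f _ m; apply: (@continuous_comp functionals R[i]^o R^o (fun m => m f) P); last exact: Pc.
    exact: ptws_eval_continuous.
  - move=> f m Wf [_ mb _]; apply: le_trans (Ple _) _; apply: le_trans (mb _) _.
    apply: bcfun_norm_le; last by move=> s; exact: Wr.
    by apply: le_trans (Wr f Wf s0); exact: normc_ge0.
have rec := part _ (@Re_continuous R) (@norm_Re_le R).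
have imc := part _ (@Im_continuous R) (@norm_Im_le R).
exists (fun m => 'i%C *: (re (fun f => complex.Im (m f)) : E) + re (fun f => complex.Re (m f))).
split.
  apply/subspace_continuousP => m mm; apply: weak_cvg_lin.
    exact: (subspace_continuousP _ _).1 imc m mm.
  exact: (subspace_continuousP _ _).1 rec m mm.
move=> m mm t.
have mRec : continuous ((fun f => complex.Re (m f)) : weak CS -> R^o).
  move=> f; apply: (@continuous_comp (weak CS) R[i]^o R^o m (@complex.Re R)).
    exact: dualc.
  exact: Re_continuous.
have mImc : continuous ((fun f => complex.Im (m f)) : weak CS -> R^o).
  move=> f; apply: (@continuous_comp (weak CS) R[i]^o R^o m (@complex.Im R)).
    exact: dualc.
  exact: Im_continuous.
change ('i%C * (re (fun f => complex.Im (m f)) t : R[i]) +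
  (re (fun f => complex.Re (m f)) t : R[i]) = m (translates t)).
rewrite (pullbackE Wc fW fc t mRec) (pullbackE Wc fW fc t mImc).
by case: (m (translates t)) => x y; simpc.
Qed.

Lemma translates_continuous (t : translate_index) :
  continuous ((fun s => left_translation s (translates t)) : S -> weak CS).
Proof.
rewrite /translates; case: ifP => [/fsW tW|_].
  case: t.2 => [u|]; last exact: WAP_translation_continuous.
  have -> : (fun s => left_translation s (left_translation u t.1)) =
      (fun s => left_translation s t.1 : weak CS) \o (fun s => u * s)%g.
    by apply/funext => s; exact: left_translationM.
  move=> s; apply: (@continuous_comp S S (weak CS) (fun s => u * s)%g).
    exact: mulg_continuousl.
  exact: WAP_translation_continuous.
have -> : (fun s => left_translation s 0) = (fun=> 0 : CS).
  by apply/funext => s; exact: bcfun_eqP.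
by move=> s; exact: (@cvg_cst (weak CS)).
Qed.

Lemma shift_fun_subproof (s : S) (g : E) :
  ((fun t => g (index_shift s t)) : translate_index -> R[i]^o)
    \in @bounded_continuous R translate_index.
Proof.
have /asboolP[/bounded_fun_normcP[M gM] _] := bcfunP g.
apply/asboolP; split; first by apply/bounded_fun_normcP; exists M.
exact: discrete_continuous.
Qed.

Definition shift_fun (s : S) (g : E) : E := BCFun (shift_fun_subproof s g).

Lemma shift_fun_nonexp s (g h : E) : `|shift_fun s g - shift_fun s h| <= `|g - h|.
Proof.
rewrite !bcfun_normE lecR; apply: bcfun_norm_le => [|t]; first exact: bcfun_norm_ge0.
exact: (bcfun_norm_ub (g - h) (index_shift s t)).
Qed.

Lemma ultralimit (U : set_system S) (g : E) (t : translate_index) : UltraFilter U ->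
  exists z : R[i]^o, (fun s => g (index_shift s t) : R[i]^o) @ U --> z.
Proof.
move=> UU; pose h (s : S) : R[i]^o := g (index_shift s t).
have [|z [_ zcl]] := @rectangle_compact R (bcfun_norm g) (h @ U) _.
  apply: (@filterS _ U _ setT) => [s _|]; last exact: filterT.
  by split; apply: le_trans (bcfun_norm_ub g (index_shift s t));
    [exact: norm_Re_le|exact: norm_Im_le].
exists z => N zN; have [//|UN] := in_ultra_setVsetC (h @^-1` N) UU.
by have [y []] := zcl (~` N) N UN zN.
Qed.

(** The limit along an ultrafilter of the [s]-translated coordinate [t] is a
    functional on the whole space. This makes the coordinates of a pointwise
    limit of the action weakly continuous. *)
Lemma ultralimit_dual (U : set_system S) (t : translate_index) : UltraFilter U ->
  exists phi : dual E, forall g : E,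
    (fun s => g (index_shift s t) : R[i]^o) @ U --> sval phi g.
Proof.
move=> UU; pose lim (g : E) : R[i]^o := sval (cid (ultralimit g t UU)).
have limP (g : E) : (fun s => g (index_shift s t) : R[i]^o) @ U --> lim g :=
  svalP (cid (ultralimit g t UU)).
have hC : hausdorff_space (R[i]^o) by exact: norm_hausdorff.
have lim_lin : linear lim.
  move=> a g h; apply: (@cvg_unique _ hC _ _ _ _ (limP (a *: g + h))).
  apply: (cvgD (f := fun s => a *: (g (index_shift s t) : R[i]^o))
    (g := fun s => h (index_shift s t) : R[i]^o)); last exact: limP.
  by apply: cvgZl_tmp; exact: limP.
have [|phi phiE] := @bounded_linear_dual R[i] E lim 1 lim_lin ler01.
  move=> g; rewrite mul1r normCE bcfun_normE lecR; apply/ler_addgt0Pr => e e0.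
  have [s hs] := @filter_ex _ U _ _ ((complex_cvgP _ _ _).1 (limP g) e e0).
  rewrite -[lim g](subrK (g (index_shift s t))) addrC.
  apply: le_trans (le_normcD _ _) _; rewrite lerD ?bcfun_norm_ub//.
  exact: ltW.
by exists phi => g; rewrite phiE; exact: limP.
Qed.

(** The fixed point property is applied to the image of the set of means under
    the map of [weak_evaluation_map], where [S] acts by shifting the indices. On
    this compact set, continuity can be checked on coordinates: those of [act]
    are coordinates again or values of a mean on translates, and those of a
    pointwise limit of [act] are given by [ultralimit_dual]. *)
Theorem finite_invariant_mean : fixed_point_property S R[i] ->
  exists2 m, means m & forall f, f \in fs -> forall s, m (left_translation s f) = m f.
Proof.
move=> fpp; have [Psi [Psic PsiE]] := weak_evaluation_map.
pose A : set E := Psi @` means.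
have An0 : A !=set0 by exists (Psi (fun f => f s0)), (fun f => f s0) => //; exact: means_eval.
have Ac : compact (A : set (weak E)).
  by apply: continuous_compact => //; exact: means_compact.
have Aconv : convex_set (A : set (convex_lmodType E)).
  move=> x y l /set_mem[m mm <-] /set_mem[m' mm' <-]; apply/mem_set.
  exists (fun f => (l%:num : R[i]) * m f + (1 - l%:num) * m' f).
    by exact: means_convex.
  apply: bcfun_eqP => t; rewrite PsiE; last by exact: means_convex.
  change ((l%:num : R[i]) * m (translates t) + (1 - l%:num) * m' (translates t) =
    (l%:num : R[i]) * ((Psi m : E) t : R[i]) + (1 - l%:num) * ((Psi m' : E) t : R[i])).
  by rewrite !PsiE.
have shift_funA s x : A x -> A (shift_fun s x).
  move=> [m mm <-]; exists (translate_functional s m); first exact: means_translate.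
  apply: bcfun_eqP => t; rewrite PsiE; last exact: means_translate.
  by rewrite /= PsiE// translates_shift.
pose X := weak_subset A.
pose act (s : S) (x : X) : X :=
  exist (fun z : weak E => z \in (A : set (weak E))) (shift_fun s (val x))
    (mem_set (shift_funA s _ (set_mem (valP x)))).
pose coord (t : translate_index) (x : X) : R[i]^o := (val x : E) t.
have coordc t : continuous (coord t).
  move=> x; apply: (@continuous_comp X (weak E) R[i]^o val (fun f : E => f t)).
    exact: weak_subset_val_continuous.
  exact: bcfun_eval_weak_continuous.
have coord_inj (x y : X) : (forall t, coord t x = coord t y) -> x = y.
  by move=> xy; apply: val_inj; exact: bcfun_eqP.
have coord_cvg (Y : Type) (F : set_system Y) (q : Y -> X) (x : X) : Filter F ->
    (forall t, (coord t \o q) @ F --> coord t x) -> q @ F --> x.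
  move=> FF qx.
  apply: (@compact_coordinates_cvg translate_index Y X (fun=> R[i]^o) F q setT coord) => //.
  - exact: weak_subset_compact.
  - exact: filterT.
  - by move=> z _; exact: coord_inj.
have coord_act t s x : coord t (act s x) = coord (index_shift s t) x by [].
have actM : is_action act.
  move=> s u x; apply: coord_inj => t; rewrite !coord_act; congr coord.
  by case: t => f [v|]; rewrite /index_shift/= ?mulgA.
have actc : weakly_separately_continuous act.
  split=> [s x|x s].
    apply: (coord_cvg X (nbhs x) (act s) (act s x) (nbhs_filter x)) => t.
    exact: (coordc (index_shift s t) x).
  apply: (coord_cvg S (nbhs s) (act ^~ x) (act s x) (nbhs_filter s)) => t.
  have [m mm xE] := set_mem (valP x).
  have -> : coord t \o act ^~ x = fun u => m (left_translation u (translates t)).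
    by apply/funext => u /=; rewrite coord_act /coord -xE PsiE// translates_shift.
  have [phi phiE] := means_dual mm.
  have -> : (fun u => m (left_translation u (translates t))) =
      sval phi \o (fun u => left_translation u (translates t)).
    by apply/funext => u; rewrite /= phiE.
  have -> : coord t (act s x) = sval phi (left_translation s (translates t)).
    by rewrite coord_act /coord -xE PsiE// translates_shift phiE.
  apply: (@continuous_comp S (weak CS) R[i]^o (fun u => left_translation u (translates t))).
    exact: translates_continuous.
  exact: dual_continuous.
have quasi : weakly_quasi_equicontinuous act.
  move=> g gcl.
  pose act' : S -> {ptws X -> X} := act.
  pose F0 := filter_from (nbhs (g : {ptws X -> X})) (fun N => act' @^-1` N).
  have F0F : Filter F0.
    apply: filter_from_filter; first by exists setT; exact: filterT.
    by move=> M N gM gN; exists (M `&` N) => //; exact: filterI.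
  have F0P : ProperFilter F0.
    apply: filter_from_proper => N gN.
    by have [_ [s _ <-] Ns] := closure_near gcl gN; exists s.
  have [U [UU F0U]] := ultraFilterLemma F0P.
  have Ug : act' @ U --> (g : {ptws X -> X}) by move=> N gN; apply: F0U; exists N.
  have gE t : exists phi : dual E, forall x : X, coord t (g x) = sval phi (val x).
    have [phi phiP] := ultralimit_dual t UU; exists phi => x.
    have hC : hausdorff_space (R[i]^o) by exact: norm_hausdorff.
    apply: (@cvg_unique _ hC _ _ _ _ _ (phiP (val x))).
    have Ugx := cvg_comp _ _ Ug (@ptws_eval_continuous X X x (g : {ptws X -> X})).
    exact: (cvg_comp _ _ Ugx (coordc t (g x))).
  move=> x; apply: (coord_cvg X (nbhs x) g (g x) (nbhs_filter x)) => t; have [phi phiE] := gE t.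
  have -> : coord t \o g = fun x : X => sval phi (val x).
    by apply/funext => y; exact: phiE.
  by rewrite phiE; exact: dual_weak_subset_continuous.
have nonexp : nonexpansive act by move=> s x y; exact: shift_fun_nonexp.
have [x xfix] := fpp E A An0 Ac Aconv act actM actc quasi nonexp.
have [m mm xE] := set_mem (valP x).
exists m => // f ffs s.
have := congr1 (coord (f, None)) (xfix s).
rewrite coord_act /coord -xE !PsiE// translates_shift.
by rewrite /translates/= ffs.
Qed.

End finite_families.

(** * Fixed points give a left invariant mean *)

Section fixed_point_implies_mean.
Context (R : realType) (S : semitopologicalSemigroupType) (s0 : S).
Local Notation CS := (bcfun R S).
Local Notation functionals := {ptws CS -> R[i]^o}.
Local Notation means := (@means R S).
Local Notation WAP := (@WAP R S).

Lemma cst_WAP (a : R[i]) : WAP (bcfun_cst S a).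
Proof.
exists [set bcfun_cst S a]; first by move=> _ [s _ <-]; exact: left_translation_cst.
split; first exact: compact_set1.
exact: accessible_closed_set1 (hausdorff_accessible (@weak_bcfun_hausdorff R S)) _.
Qed.

Lemma eq_functional_closed (f g : CS) : closed [set m : functionals | m f = m g].
Proof.
have -> : [set m : functionals | m f = m g] =
    (fun m : functionals => m f - (0 *: (m f : R[i]^o) + m g)) @^-1` [set (0 : R[i]^o)].
  apply/seteqP; split=> m /=; rewrite scale0r add0r; first by move=> ->; rewrite subrr.
  by move/eqP; rewrite subr_eq0 => /eqP.
apply: preimage_closed; last first.
  exact: accessible_closed_set1 (hausdorff_accessible (@norm_hausdorff _ _)) _.
move=> m _; apply: (@linear_defect_continuous R functionals 0 (fun m => m f)
  (fun m => m f) (fun m => m g)); exact: ptws_eval_continuous.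
Qed.

(** The means invariant on a finite list of functions form closed nonempty
    subsets of the compact set of means, directed by concatenation of lists. *)
Theorem fixed_point_mean : fixed_point_property S R[i] ->
  exists m : CS -> R[i], left_invariant_mean WAP m.
Proof.
move=> fpp.
have hm : hausdorff_space functionals by apply: hausdorff_ptws; exact: norm_hausdorff.
pose inv (fs : seq CS) : set functionals := means `&`
  [set m | forall f, f \in fs -> forall s, m (left_translation s f) = m f].
have [m minv] : \bigcap_(fs in [set fs : seq CS | forall f, f \in fs -> WAP f]) inv fs !=set0.
  apply: (directed_bigcap (@means_compact R S)).
  - by exists [::].
  - move=> fs fsW; split.
    + have -> : inv fs = means `&` \bigcap_(fs in [set fs' : CS * S | fs'.1 \in fs])
          [set m : functionals | m (left_translation fs.2 fs.1) = m fs.1].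
        apply/seteqP; split=> m [mm mE]; split=> //.
          by move=> [f s] /= ffs; exact: mE.
        by move=> f ffs s; exact: (mE (f, s)).
      apply: closedI; first by apply: compact_closed => //; exact: means_compact.
      by apply: closed_bigI => -[f s] _; exact: eq_functional_closed.
    + by move=> m [].
    + by have [m mm mE] := finite_invariant_mean s0 fsW fpp; exists m.
  - move=> fs gs fsW gsW; exists (fs ++ gs).
      by move=> f; rewrite mem_cat => /orP[/fsW|/gsW].
    move=> m [mm mE]; split; split=> // f ffs; apply: mE; rewrite mem_cat ffs ?orbT//.
have [[mlin mb m1] _] := minv [::] (fun f (h : f \in [::]) => False_ind _ (notF h)).
exists m; split=> //.
- apply/eqP; rewrite eq_le; apply/andP; split.
    apply: ge_ereal_sup => _ [f [_ f1] <-]; rewrite lee_fin.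
    by apply: le_trans (mb f) _; rewrite -lecR.
  apply: ereal_sup_ubound; exists (bcfun_cst S (1 : R[i])); last by rewrite m1 normc1.
  split; first exact: cst_WAP.
  change ((bcfun_norm (bcfun_cst S (1 : R[i])))%:C <= 1%:C); rewrite lecR.
  by apply: bcfun_norm_le => // s; rewrite normc1.
- move=> s f fW; have [|_ /(_ f)] := minv [:: f].
    by move=> g; rewrite inE => /eqP ->.
  by rewrite inE eqxx => /(_ isT).
Qed.

End fixed_point_implies_mean.

Theorem theorem3p1 (R : realType) (S : semitopologicalSemigroupType) :
  [set: S] !=set0 ->
  (exists m : bcfun R S -> R[i], left_invariant_mean (@WAP R S) m) <->
  (fixed_point_property S R /\ fixed_point_property S R[i]).
Proof.
move=> S0; split=> [[m mLIM]|[_ fpp]].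
  split; first exact: mean_fixed_point_real mLIM.
  exact: mean_fixed_point_complex mLIM.
have [s0 _] := S0; exact: fixed_point_mean fpp.
Qed.
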